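(* As $h$ ranges over all primitive vectors of positive norm in $U+E_8(-1)$, the subgroups $\Gamma_h^+\subset \mathrm{O}^+(N)$ (defined in the context) form exactly $87$ conjugacy classes of subgroups of $\mathrm{O}^+(N)$.
   Context: $U$ is the hyperbolic plane, $E_8(-1)$ the negative definite $E_8$-lattice, and for a lattice $\Lambda$ and an integer $m$, $\Lambda(m)$ denotes $\Lambda$ with its bilinear form multiplied by $m$; $+$ denotes orthogonal direct sum. Put $$M = U(2)+E_8(-2),\qquad M(1/2)=U+E_8(-1),\qquad N=U+U(2)+E_8(-2),$$ so $N$ has signature $(2,10)$. For an even lattice $\Lambda$, $D(\Lambda)=\Lambda^\vee/\Lambda$ is its discriminant group with its induced quadratic form $q_\Lambda$, and $\mathrm{O}(D(\Lambda))$ is the group of automorphisms preserving $q_\Lambda$. Let $\pi_M:\mathrm{O}(M)\to \mathrm{O}(D(M))$ and $\pi_N:\mathrm{O}(N)\to\mathrm{O}(D(N))$ be the natural maps; both are surjective. Let $L_{K3}=3U+2E_8(-1)$. The lattice $M$ is embedded primitively in $L_{K3}$ by $(x,u)\mapsto(x,0,x,u,u)$ and $N$ is identified with $M^\perp_{L_{K3}}$ by $(y,z,v)\mapsto(z,y,-z,v,-v)$, where $y\in U$, $z\in U(2)$, $v\in E_8(-2)$. Since $L_{K3}$ is unimodular this gives a natural isomorphism $(D(M),q_M)\cong(D(N),-q_N)$, which is used to identify $D(M)$ with $D(N)$ and $\mathrm{O}(D(M))$ with $\mathrm{O}(D(N))$ (this group is isomorphic to the orthogonal group $\mathrm{O}^+(\mathbb{F}_2^{10})$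 of even type). For a primitive vector $h\in M(1/2)$ with $h^2>0$ let $\mathrm{O}(M,h)=\{g\in\mathrm{O}(M)=\mathrm{O}(M(1/2))\mid g(h)=h\}$ and define $$\Gamma_h=\pi_N^{-1}\bigl(\pi_M(\mathrm{O}(M,h))\bigr)\subset\mathrm{O}(N),\qquad \Gamma_h^+=\Gamma_h\cap\mathrm{O}^+(N).$$ Here $\mathrm{O}^+(N)\subset\mathrm{O}(N)$ is the index $2$ subgroup of isometries with real spinor norm $1$, i.e. those mapping to itself a connected component $\mathcal{D}_N$ of $\Omega_N=\{[w]\in\mathbb{P}(N\otimes\mathbb{C})\mid (w,w)=0,\ (w,\bar w)>0\}$. *)

(* Defs.v *)
From HB Require Import structures.
From mathcomp Require Import all_boot all_order all_algebra.
From mathcomp Require Import archimedean generic_quotient ring_quotient monoid.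
From mathcomp Require Import boolp classical_sets functions cardinality reals.
From mathcomp Require Import topology normedtype.
From mathcomp Require Import complex.
From mathcomp Require Import ring.

Set Implicit Arguments.
Unset Strict Implicit.
Unset Printing Implicit Defensive.

Import Order.TTheory GRing.Theory Num.Theory.
Import numFieldNormedType.Exports.

Local Open Scope quotient_scope.
Local Open Scope classical_set_scope.
Local Open Scope ring_scope.

(* An even lattice of rank n is Z^n, seen as column vectors, with an integral *)
(* symmetric Gram matrix having an even diagonal.                             *)
Record lattice (n : nat) := Lattice {
  gram :> 'M[int]_n;
  gram_sym : gram^T = gram;
  gram_even : forall i, (2 %| gram i i)%Z
}.

Section LatticeConstructions.

Lemma lscale_sym n (m : int) (L : lattice n) : (m *: gram L)^T = m *: gram L.
Proof. by rewrite linearZ /= gram_sym. Qed.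

Lemma lscale_even n (m : int) (L : lattice n) i : (2 %| (m *: gram L) i i)%Z.
Proof. by rewrite mxE dvdz_mull // gram_even. Qed.

Definition lscale n (m : int) (L : lattice n) :=
  Lattice (lscale_sym m L) (lscale_even m L).

Lemma lsum_sym n1 n2 (L1 : lattice n1) (L2 : lattice n2) :
  (block_mx L1 0 0 L2)^T = block_mx L1 0 0 L2.
Proof. by rewrite tr_block_mx !gram_sym !trmx0. Qed.

Lemma lsum_even n1 n2 (L1 : lattice n1) (L2 : lattice n2) i :
  (2 %| (block_mx L1 0 0 L2) i i)%Z.
Proof.
by case: (split_ordP i) => j ->; rewrite ?block_mxEul ?block_mxEdr gram_even.
Qed.

Definition lsum n1 n2 (L1 : lattice n1) (L2 : lattice n2) :=
  Lattice (lsum_sym L1 L2) (lsum_even L1 L2).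

Definition hyp_gram : 'M[int]_2 := \matrix_(i, j) (i != j)%:R.

Lemma hyp_sym : hyp_gram^T = hyp_gram.
Proof. by apply/matrixP => i j; rewrite !mxE eq_sym. Qed.

Lemma hyp_even i : (2 %| hyp_gram i i)%Z.
Proof. by rewrite mxE eqxx. Qed.

Definition hypU := Lattice hyp_sym hyp_even.

(* Dynkin diagram E_8: a chain 0 - 1 - ... - 6, with 7 attached to 2. *)
Definition E8_edge (i j : 'I_8) : bool :=
  [|| (j == i.+1 :> nat) && (j < 7)%N | (i == 2%N :> nat) && (j == 7%N :> nat)].

Definition E8_gram : 'M[int]_8 :=
  \matrix_(i, j) (if i == j then 2
                  else if E8_edge i j || E8_edge j i then -1 else 0).

Lemma E8_sym : E8_gram^T = E8_gram.
Proof. by apply/matrixP => i j; rewrite !mxE eq_sym orbC. Qed.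

Lemma E8_even i : (2 %| E8_gram i i)%Z.
Proof. by rewrite mxE eqxx. Qed.

Definition E8 := Lattice E8_sym E8_even.

End LatticeConstructions.


Definition latMhalf := lsum hypU (lscale (-1) E8).
Definition latM := lsum (lscale 2 hypU) (lscale (-2) E8).
Definition latN := lsum (lsum hypU (lscale 2 hypU)) (lscale (-2) E8).
Definition latK3 :=
  lsum (lsum (lsum (lsum hypU hypU) hypU) (lscale (-1) E8)) (lscale (-1) E8).

(* The K-bilinear extension of the form of L to L (x) K. *)
Definition bform n (L : lattice n) (K : comNzRingType) (x y : 'cV[K]_n) : K :=
  (x^T *m map_mx intr (gram L) *m y) 0 0.

Section Isometries.
Variables (n : nat) (L : lattice n).

Record isometry := Isometry {
  isom_mx :> 'M[int]_n;
  isomP : (isom_mx \in unitmx) && (isom_mx^T *m gram L *m isom_mx == gram L)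
}.

HB.instance Definition _ := [isSub for isom_mx].
HB.instance Definition _ := [Choice of isometry by <:].

Lemma isom_unit (g : isometry) : isom_mx g \in unitmx.
Proof. by case/andP: (isomP g). Qed.

Lemma isom_gram (g : isometry) : (isom_mx g)^T *m gram L *m isom_mx g = gram L.
Proof. by case/andP: (isomP g) => _ /eqP. Qed.

Lemma isom1P : ((1%:M : 'M[int]_n) \in unitmx) && ((1%:M)^T *m gram L *m 1%:M == gram L).
Proof. by rewrite unitmx1 trmx1 mul1mx mulmx1 eqxx. Qed.

Lemma isomMP (g h : isometry) :
  (isom_mx g *m isom_mx h \in unitmx) &&
  ((isom_mx g *m isom_mx h)^T *m gram L *m (isom_mx g *m isom_mx h) == gram L).
Proof.
rewrite unitmx_mul !isom_unit /= trmx_mul -!mulmxA.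
by rewrite (mulmxA _ (isom_mx g)) (mulmxA _ _ (isom_mx h)) (mulmxA _ (gram L))
  isom_gram mulmxA isom_gram.
Qed.

Lemma isomVP (g : isometry) :
  (invmx (isom_mx g) \in unitmx) &&
  ((invmx (isom_mx g))^T *m gram L *m invmx (isom_mx g) == gram L).
Proof.
rewrite unitmx_inv isom_unit /= -{1}(isom_gram g) !mulmxA -trmx_mul.
by rewrite mulmxV ?isom_unit // trmx1 mul1mx -mulmxA mulmxV ?isom_unit // mulmx1.
Qed.

Definition isom_one := Isometry isom1P.
Definition isom_mul g h := Isometry (isomMP g h).
Definition isom_inv g := Isometry (isomVP g).

Fact isom_mulA : associative isom_mul.
Proof. by move=> x y z; apply: val_inj; rewrite /= mulmxA. Qed.
Fact isom_mul1 : left_id isom_one isom_mul.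
Proof. by move=> x; apply: val_inj; rewrite /= mul1mx. Qed.
Fact isom_1mul : right_id isom_one isom_mul.
Proof. by move=> x; apply: val_inj; rewrite /= mulmx1. Qed.
Fact isom_mulV : left_inverse isom_one isom_inv isom_mul.
Proof. by move=> x; apply: val_inj; rewrite /= mulVmx ?isom_unit. Qed.
Fact isom_Vmul : right_inverse isom_one isom_inv isom_mul.
Proof. by move=> x; apply: val_inj; rewrite /= mulmxV ?isom_unit. Qed.

HB.instance Definition _ := isGroup.Build isometry
  isom_mulA isom_mul1 isom_1mul isom_mulV isom_Vmul.

Definition isom_act (K : comNzRingType) (g : isometry) (x : 'cV[K]_n) : 'cV[K]_n :=
  map_mx intr (isom_mx g) *m x.

Lemma isom_act_form (K : comNzRingType) g (x y : 'cV[K]_n) :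
  bform L (isom_act g x) (isom_act g y) = bform L x y.
Proof.
have gE : map_mx intr (gram L) =
    (map_mx intr (isom_mx g))^T *m map_mx intr (gram L) *m map_mx intr (isom_mx g)
    :> 'M[K]_n by rewrite map_trmx -!map_mxM isom_gram.
by rewrite /bform /isom_act trmx_mul [in RHS]gE !mulmxA.
Qed.

Lemma isom_actB (K : comNzRingType) g (x y : 'cV[K]_n) :
  isom_act g (x - y) = isom_act g x - isom_act g y.
Proof. exact: mulmxBr. Qed.

Lemma isom_actK (K : comNzRingType) g (x : 'cV[K]_n) :
  isom_act g^-1%g (isom_act g x) = x.
Proof.
by rewrite /isom_act mulmxA -map_mxM /= mulVmx ?isom_unit // map_mx1 mul1mx.
Qed.

Lemma isom_actVK (K : comNzRingType) g (x : 'cV[K]_n) :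
  isom_act g (isom_act g^-1%g x) = x.
Proof.
by rewrite /isom_act mulmxA -map_mxM /= mulmxV ?isom_unit // map_mx1 mul1mx.
Qed.

End Isometries.

Section Forms.
Variables (n : nat) (L : lattice n) (K : comNzRingType).
Implicit Types x y z : 'cV[K]_n.

Lemma bformDl x y z : bform L (x + y) z = bform L x z + bform L y z.
Proof. by rewrite /bform linearD /= !mulmxDl mxE. Qed.

Lemma bformNl x z : bform L (- x) z = - bform L x z.
Proof. by rewrite /bform linearN /= !mulNmx mxE. Qed.

Lemma bformC x y : bform L x y = bform L y x.
Proof.
rewrite /bform -[LHS]/((_ *m y) 0 0) -[in LHS](trmxK (_ *m y)) [LHS]mxE.
by rewrite !trmx_mul trmxK map_trmx gram_sym mulmxA.
Qed.

Lemma bform0l z : bform L 0 z = 0.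
Proof. by rewrite /bform trmx0 !mul0mx mxE. Qed.

Lemma bformDr x y z : bform L z (x + y) = bform L z x + bform L z y.
Proof. by rewrite bformC bformDl !(bformC z). Qed.

Lemma bformNr x z : bform L z (- x) = - bform L z x.
Proof. by rewrite bformC bformNl (bformC z). Qed.

End Forms.

Section Discriminant.
Variables (n : nat) (L : lattice n).

Definition integral_vec (x : 'cV[rat]_n) := [forall i, x i 0 \is a Num.int].

Lemma integral_vecP x :
  reflect (exists y : 'cV[int]_n, x = map_mx intr y) (integral_vec x).
Proof.
apply: (iffP forallP) => [xZ|[y ->] i]; last by rewrite mxE intr_int.
exists (\col_i Num.floor (x i 0)); apply/colP => i.
by rewrite !mxE floorK.
Qed.

Definition in_dual : {pred 'cV[rat]_n} := fun x =>
  `[< forall y, integral_vec y -> bform L x y \is a Num.int >].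

Lemma in_dual_zmod_closed : zmod_closed in_dual.
Proof.
split=> [|x y /asboolP xP /asboolP yP]; apply/asboolP => z zZ.
  by rewrite bform0l rpred0.
by rewrite bformDl bformNl rpredB ?xP ?yP.
Qed.
HB.instance Definition _ :=
  GRing.isZmodClosed.Build 'cV[rat]_n in_dual in_dual_zmod_closed.

Record dual_lattice := DualVec {
  dual_val :> 'cV[rat]_n;
  dual_valP : dual_val \in in_dual
}.
HB.instance Definition _ := [isSub for dual_val].
HB.instance Definition _ := [Choice of dual_lattice by <:].
HB.instance Definition _ := [SubChoice_isSubZmodule of dual_lattice by <:].

Definition dual_integral : {pred dual_lattice} := fun x => integral_vec (dual_val x).

Lemma dual_integral_zmod_closed : zmod_closed dual_integral.
Proof.
split=> [|x y /forallP xP /forallP yP]; apply/forallP => i /=.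
  by rewrite mxE rpred0.
by rewrite !mxE rpredB.
Qed.
HB.instance Definition _ :=
  GRing.isZmodClosed.Build dual_lattice dual_integral dual_integral_zmod_closed.

Definition disc_group := Quotient.quot dual_integral.
HB.instance Definition _ := GRing.Zmodule.on disc_group.
HB.instance Definition _ := generic_quotient.Quotient.on disc_group.

End Discriminant.

Definition even_rat : {pred rat} := fun x => x / 2 \is a Num.int.

Lemma even_rat_zmod_closed : zmod_closed even_rat.
Proof.
split=> [|x y xP yP]; rewrite unfold_in ?mul0r ?rpred0 //.
by rewrite mulrBl rpredB.
Qed.
HB.instance Definition _ := GRing.isZmodClosed.Build rat even_rat even_rat_zmod_closed.

Definition rat_mod2 := Quotient.quot even_rat.
HB.instance Definition _ := GRing.Zmodule.on rat_mod2.
HB.instance Definition _ := generic_quotient.Quotient.on rat_mod2.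

Section DiscForm.
Variables (n : nat) (L : lattice n).
Implicit Types (x y : dual_lattice L) (d e : disc_group L).

Lemma disc_eqP x y :
  reflect (\pi_(disc_group L) x = \pi y) (integral_vec (dual_val x - dual_val y)).
Proof. by apply: (iffP idP) => [xy|/eqP]; [apply/eqP|]; rewrite piE. Qed.

Lemma disc_piD x y : \pi_(disc_group L) (x + y) = \pi x + \pi y :> disc_group L.
Proof. exact: Quotient.pi_add. Qed.

(* The value q_L(d) = (x, x) mod 2Z for any x in the class d: see discformE. *)
Definition discform d : rat_mod2 :=
  \pi_rat_mod2 (bform L (dual_val (repr d)) (dual_val (repr d))).

Lemma gram_half : exists B : 'M[int]_n, gram L = B + B^T.
Proof.
exists (\matrix_(i, j) (if (i < j)%N then L i j else
                        if i == j then (L i i %/ 2)%Z else 0)).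
apply/matrixP => i j; rewrite !mxE (eq_sym j i).
case: ltngtP => [ij|ij|/val_inj ij].
- by rewrite -val_eqE (ltn_eqF ij) addr0.
- by rewrite -val_eqE (gtn_eqF ij) add0r -[in LHS]gram_sym mxE.
- rewrite ij eqxx -mulr2n -[RHS]mulr_natr natz; exact: (esym (divzK (gram_even L j))).
Qed.

Lemma form_even (x : 'cV[rat]_n) : integral_vec x -> bform L x x / 2 \is a Num.int.
Proof.
case/integral_vecP => y ->; have [B LE] := gram_half.
have -> : bform L (map_mx intr y) (map_mx intr y) = ((y^T *m gram L *m y) 0 0)%:~R :> rat.
  by rewrite /bform map_trmx -!map_mxM mxE.
rewrite LE mulmxDr mulmxDl mxE.
have -> : (y^T *m B^T *m y) 0 0 = (y^T *m B *m y) 0 0.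
  by rewrite -[RHS]/((y^T *m B *m y) 0 0) -[in RHS](trmxK (_ *m y)) [RHS]mxE
    !trmx_mul trmxK mulmxA.
by rewrite -mulr2n rmorphMn /= -[X in X / _]mulr_natr mulfK ?intr_int.
Qed.

Lemma repr_piB x :
  integral_vec (dual_val (repr (\pi_(disc_group L) x)) - dual_val x).
Proof. by apply/disc_eqP; rewrite reprK. Qed.

Lemma discformE x : discform (\pi_(disc_group L) x) = \pi_rat_mod2 (bform L (dual_val x) (dual_val x)).
Proof.
rewrite /discform; set y := repr _; apply/eqP; rewrite piE Quotient.equivE unfold_in.
have yx := repr_piB x; rewrite -/y in yx.
have -> : bform L (dual_val y) (dual_val y) - bform L (dual_val x) (dual_val x) =
   bform L (dual_val y - dual_val x) (dual_val y - dual_val x) +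
   2 * bform L (dual_val x) (dual_val y - dual_val x).
  rewrite !(bformDl, bformDr, bformNl, bformNr) (bformC L (dual_val y) (dual_val x)).
  by ring.
rewrite mulrDl rpredD ?form_even //; rewrite mulrC mulKf //.
by have /asboolP := dual_valP x; apply.
Qed.

Record disc_isom := DiscIsom {
  disc_fun :> disc_group L -> disc_group L;
  disc_funD : {morph disc_fun : d e / d + e};
  disc_fun_bij : bijective disc_fun;
  disc_funq : forall d, discform (disc_fun d) = discform d
}.

Lemma integral_isom_act (g : isometry L) (x : 'cV[rat]_n) :
  integral_vec x -> integral_vec (isom_act g x).
Proof.
case/integral_vecP => y ->; apply/integral_vecP.
by exists (isom_mx g *m y); rewrite map_mxM.
Qed.

Lemma dual_act_subproof (g : isometry L) x : isom_act g (dual_val x) \in in_dual L.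
Proof.
apply/asboolP => y yZ; rewrite -(isom_actVK g y) isom_act_form.
by have /asboolP := dual_valP x; apply; exact: integral_isom_act.
Qed.

Definition dual_act (g : isometry L) x : dual_lattice L :=
  DualVec (dual_act_subproof g x).

Definition disc_act (g : isometry L) d : disc_group L :=
  \pi_(disc_group L) (dual_act g (repr d)).

Lemma disc_actE g x : disc_act g (\pi_(disc_group L) x) = \pi_(disc_group L) (dual_act g x).
Proof.
by apply/disc_eqP; rewrite /= -isom_actB integral_isom_act ?repr_piB.
Qed.

Lemma disc_actD g : {morph disc_act g : d e / d + e}.
Proof.
elim/quotW => x; elim/quotW => y.
rewrite -disc_piD !disc_actE -disc_piD; congr (\pi _); apply: val_inj => /=.
exact: mulmxDr.
Qed.

Lemma disc_act_bij g : bijective (disc_act g).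
Proof.
exists (disc_act g^-1%g); elim/quotW => x; rewrite (disc_actE _ x) disc_actE; congr (\pi _);
  by apply: val_inj; rewrite /= ?(isom_actK g) ?(isom_actVK g).
Qed.

Lemma disc_act_q g d : discform (disc_act g d) = discform d.
Proof. by elim/quotW: d => x; rewrite disc_actE !discformE isom_act_form. Qed.

Definition disc_map (g : isometry L) : disc_isom :=
  DiscIsom (disc_actD g) (disc_act_bij g) (disc_act_q g).

End DiscForm.

(* (x, u) |-> (x, 0, x, u, u) *)
Definition embM (K : comNzRingType) (w : 'cV[K]_(2 + 8)) :
    'cV[K]_(2 + 2 + 2 + 8 + 8) :=
  let x := usubmx w in let u := dsubmx w in
  col_mx (col_mx (col_mx (col_mx x 0) x) u) u.

(* (y, z, v) |-> (z, y, - z, v, - v) *)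
Definition embN (K : comNzRingType) (w : 'cV[K]_(2 + 2 + 8)) :
    'cV[K]_(2 + 2 + 2 + 8 + 8) :=
  let y := usubmx (usubmx w) in let z := dsubmx (usubmx w) in let v := dsubmx w in
  col_mx (col_mx (col_mx (col_mx z y) (- z)) v) (- v).

(* The image of L_K3 in D(M) (+) D(N), by projecting L_K3 to the duals of M   *)
(* and N: it is the graph of the isomorphism glue below, see glueP, glue_bij, *)
(* glueD and glue_discform.                                                   *)
Definition glued (d : disc_group latM) (e : disc_group latN) : Prop :=
  exists x y, [/\ d = \pi_(disc_group latM) x, e = \pi_(disc_group latN) y
    & integral_vec (embM (dual_val x) + embN (dual_val y))].

Definition glue (d : disc_group latM) : disc_group latN :=
  xget 0 [set e | glued d e].

Lemma integral_vecB n (x y : 'cV[rat]_n) :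
  integral_vec x -> integral_vec y -> integral_vec (x - y).
Proof. by move=> /forallP xP /forallP yP; apply/forallP => i; rewrite !mxE rpredB. Qed.

Lemma integral_vecN n (x : 'cV[rat]_n) : integral_vec (- x) = integral_vec x.
Proof. by apply: eq_forallb => i; rewrite mxE rpredN. Qed.

Lemma integral_vec0 n : integral_vec (0 : 'cV[rat]_n).
Proof. by apply/forallP => i; rewrite mxE rpred0. Qed.

Lemma integral_vecD n (x y : 'cV[rat]_n) :
  integral_vec x -> integral_vec y -> integral_vec (x + y).
Proof. by move=> xP yP; rewrite -[y]opprK integral_vecB ?integral_vecN. Qed.

Lemma integral_col_mx n1 n2 (x : 'cV[rat]_n1) (y : 'cV[rat]_n2) :
  integral_vec (col_mx x y) = integral_vec x && integral_vec y.
Proof.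
apply/forallP/andP => [xyP|[/forallP xP /forallP yP] i].
  split; apply/forallP => i; first by have := xyP (lshift n2 i); rewrite col_mxEu.
  by have := xyP (rshift n1 i); rewrite col_mxEd.
by case: (split_ordP i) => j ->; rewrite ?col_mxEu ?col_mxEd.
Qed.

Lemma integral_cmx n1 n2 (x : 'cV[rat]_(n1 + n2)) :
  integral_vec x = integral_vec (usubmx x) && integral_vec (dsubmx x).
Proof. by rewrite -integral_col_mx vsubmxK. Qed.

Lemma bform_lsum n1 n2 (L1 : lattice n1) (L2 : lattice n2) (K : comNzRingType)
    (x y : 'cV[K]_(n1 + n2)) :
  bform (lsum L1 L2) x y =
  bform L1 (usubmx x) (usubmx y) + bform L2 (dsubmx x) (dsubmx y).
Proof.
rewrite /bform -{1}[x]vsubmxK -{1}[y]vsubmxK /= map_block_mx !map_mx0.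
by rewrite tr_col_mx mul_row_block !mulmx0 addr0 add0r mul_row_col mxE.
Qed.

Lemma bform_lscale n m (L : lattice n) (K : comNzRingType) (x y : 'cV[K]_n) :
  bform (lscale m L) x y = m%:~R * bform L x y.
Proof. by rewrite /bform /= map_mxZ -scalemxAr -scalemxAl mxE. Qed.

Lemma bform_latM (K : comNzRingType) (x y : 'cV[K]_(2 + 8)) :
  bform latM x y = 2 * bform latMhalf x y.
Proof. by rewrite /latM /latMhalf !bform_lsum !bform_lscale; ring. Qed.

Lemma bform_latN (K : comNzRingType) (x y : 'cV[K]_(2 + 2 + 8)) :
  bform latN x y = bform hypU (usubmx (usubmx x)) (usubmx (usubmx y)) +
    bform latM (col_mx (dsubmx (usubmx x)) (dsubmx x))
               (col_mx (dsubmx (usubmx y)) (dsubmx y)).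
Proof. by rewrite /latN /latM !bform_lsum !col_mxKu !col_mxKd addrA. Qed.

Lemma embMB (K : comNzRingType) (x y : 'cV[K]_(2 + 8)) :
  embM (x - y) = embM x - embM y.
Proof. by rewrite /embM !linearB /= !opp_col_mx !add_col_mx oppr0 addr0. Qed.

Lemma embNB (K : comNzRingType) (x y : 'cV[K]_(2 + 2 + 8)) :
  embN (x - y) = embN x - embN y.
Proof. by rewrite /embN !linearB /= !opp_col_mx !add_col_mx. Qed.

Lemma embMD (K : comNzRingType) (x y : 'cV[K]_(2 + 8)) :
  embM (x + y) = embM x + embM y.
Proof. by rewrite /embM !linearD /= !add_col_mx addr0. Qed.

Lemma embND (K : comNzRingType) (x y : 'cV[K]_(2 + 2 + 8)) :
  embN (x + y) = embN x + embN y.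
Proof. by rewrite /embN !linearD /= !add_col_mx. Qed.

Lemma embM_bform (K : comNzRingType) (x y : 'cV[K]_(2 + 8)) :
  bform latK3 (embM x) (embM y) = bform latM x y.
Proof.
rewrite /latM /latK3 !bform_lsum !col_mxKu !col_mxKd !bform_lscale bform0l.
by ring.
Qed.

Lemma embN_bform (K : comNzRingType) (x y : 'cV[K]_(2 + 2 + 8)) :
  bform latK3 (embN x) (embN y) = bform latN x y.
Proof.
rewrite /latN /latK3 !bform_lsum !col_mxKu !col_mxKd !bform_lscale.
by rewrite !(bformNl, bformNr); ring.
Qed.

Lemma embMN_bform (K : comNzRingType) (x : 'cV[K]_(2 + 8)) (y : 'cV[K]_(2 + 2 + 8)) :
  bform latK3 (embM x) (embN y) = 0.
Proof.
rewrite /latK3 !bform_lsum !col_mxKu !col_mxKd !bform_lscale.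
by rewrite !bformNr bform0l; ring.
Qed.

Lemma integral_embM (x : 'cV[rat]_(2 + 8)) :
  integral_vec (embM x) = integral_vec x.
Proof.
rewrite [RHS]integral_cmx !integral_col_mx integral_vec0.
by case: (integral_vec _) => //=; case: (integral_vec _).
Qed.

Lemma integral_embN (y : 'cV[rat]_(2 + 2 + 8)) :
  integral_vec (embN y) = integral_vec y.
Proof.
rewrite [RHS]integral_cmx [in RHS]integral_cmx !integral_col_mx !integral_vecN.
by do 3!case: (integral_vec _).
Qed.

Lemma hypU_unimodular : gram hypU \in unitmx.
Proof.
suff /mulmx1_unit[] : gram hypU *m gram hypU = 1%:M by [].
by apply/matrixP => -[[|[|//]] ?] [[|[|//]] ?]; rewrite !mxE !big_ord_recl big_ord0 !mxE.
Qed.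

Definition E8_inv : 'M[int]_8 := \matrix_(i, j)
  (nth 0%N (nth [::] [:: [:: 4; 7; 10; 8; 6; 4; 2; 5];
    [:: 7; 14; 20; 16; 12; 8; 4; 10]; [:: 10; 20; 30; 24; 18; 12; 6; 15];
    [:: 8; 16; 24; 20; 15; 10; 5; 12]; [:: 6; 12; 18; 15; 12; 8; 4; 9];
    [:: 4; 8; 12; 10; 8; 6; 3; 6]; [:: 2; 4; 6; 5; 4; 3; 2; 3];
    [:: 5; 10; 15; 12; 9; 6; 3; 8]] i) j)%:Z.

Lemma E8_unimodular : gram E8 \in unitmx.
Proof.
suff /mulmx1_unit[] : gram E8 *m E8_inv = 1%:M by [].
apply/matrixP => -[[|[|[|[|[|[|[|[|//]]]]]]]] ?] [[|[|[|[|[|[|[|[|//]]]]]]]] ?];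
  by rewrite !mxE !big_ord_recl big_ord0 !mxE.
Qed.

Lemma latMhalf_unimodular : gram latMhalf \in unitmx.
Proof.
rewrite unitmxE /= det_ublock unitrM -!unitmxE hypU_unimodular /=.
by rewrite scaleN1r unitmxE -scaleN1r detZ unitrM unitrX ?unitrN1 // -unitmxE E8_unimodular.
Qed.

Lemma unimodular_dual n (L : lattice n) (x : 'cV[rat]_n) : gram L \in unitmx ->
  (forall y, integral_vec y -> bform L x y \is a Num.int) -> integral_vec x.
Proof.
move=> LU xL; apply/forallP => i.
have -> : x i 0 = bform L x (map_mx intr (invmx (gram L) *m delta_mx i 0)).
  by rewrite /bform -mulmxA -map_mxM mulmxA mulmxV // mul1mx map_delta_mx -colE !mxE.
by apply: xL; apply/integral_vecP; eexists.
Qed.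

Lemma dual_latM x :
  x \in in_dual latM -> integral_vec (usubmx x *+ 2) /\ integral_vec (dsubmx x *+ 2).
Proof.
move=> /asboolP xM; apply/andP; rewrite -!linearMn -integral_cmx.
apply: (unimodular_dual latMhalf_unimodular) => y /xM.
have -> // : bform latMhalf (x *+ 2) y = bform latM x y.
by rewrite mulr2n bformDl bform_latM; ring.
Qed.

Lemma dual_latN y : y \in in_dual latN -> integral_vec (usubmx (usubmx y)) /\
  col_mx (dsubmx (usubmx y)) (dsubmx y) \in in_dual latM.
Proof.
move=> /asboolP yN; split.
  apply: (unimodular_dual hypU_unimodular) => p pZ.
  have := yN (col_mx (col_mx p 0) 0).
  rewrite bform_latN !col_mxKu !col_mxKd col_mx0 (bformC latM) bform0l addr0.
  by apply; rewrite !integral_col_mx pZ !integral_vec0.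
apply/asboolP => w wZ; have := yN (col_mx (col_mx 0 (usubmx w)) (dsubmx w)).
rewrite bform_latN !col_mxKu !col_mxKd vsubmxK (bformC hypU) bform0l add0r; apply.
by rewrite !integral_col_mx integral_vec0 -integral_cmx.
Qed.

Lemma glued_fun d e e' : glued d e -> glued d e' -> e = e'.
Proof.
move=> [x [y [-> -> xyZ]]] [x' [y' [/disc_eqP xx' -> xyZ']]]; apply/disc_eqP.
rewrite -integral_embN embNB.
have -> : embN (dual_val y) - embN (dual_val y') = (embM (dual_val x) + embN (dual_val y)) -
  (embM (dual_val x') + embN (dual_val y')) - embM (dual_val x - dual_val x').
  by rewrite embMB opprD addrACA [X in _ = X - _]addrC addrK.
by rewrite !integral_vecB // integral_embM.
Qed.

Lemma glued_inj d d' e : glued d e -> glued d' e -> d = d'.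
Proof.
move=> [x [y [-> -> xyZ]]] [x' [y' [-> /disc_eqP yy' xyZ']]]; apply/disc_eqP.
rewrite -integral_embM embMB.
have -> : embM (dual_val x) - embM (dual_val x') = (embM (dual_val x) + embN (dual_val y)) -
  (embM (dual_val x') + embN (dual_val y')) - embN (dual_val y - dual_val y').
  by rewrite embNB opprD addrACA addrK.
by rewrite !integral_vecB // integral_embN.
Qed.

Lemma glued_total d : exists e, glued d e.
Proof.
elim/quotW: d => x; have /asboolP xM := dual_valP x.
pose y : 'cV[rat]_(2 + 2 + 8) :=
  col_mx (col_mx 0 (usubmx (dual_val x))) (dsubmx (dual_val x)).
have yN : y \in in_dual latN.
  apply/asboolP => w; rewrite !integral_cmx bform_latN !col_mxKu !col_mxKd.
  move=> /andP[/andP[_ zZ] vZ].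
  by rewrite bform0l add0r vsubmxK xM // integral_col_mx zZ.
exists (\pi_(disc_group latN) (DualVec yN)); exists x, (DualVec yN); split=> //=.
have [aZ uZ] := dual_latM (dual_valP x).
rewrite /embM /embN !col_mxKu !col_mxKd !add_col_mx !integral_col_mx !subrr.
by rewrite addr0 !integral_vec0 -!mulr2n aZ uZ.
Qed.

Lemma glued_surj e : exists d, glued d e.
Proof.
elim/quotW: e => y; have [pZ xM] := dual_latN (dual_valP y).
exists (\pi_(disc_group latM) (DualVec xM)); exists (DualVec xM), y; split=> //=.
have [] := dual_latM xM; rewrite !col_mxKu !col_mxKd => aZ uZ.
rewrite /embM /embN !col_mxKu !col_mxKd !add_col_mx !integral_col_mx !subrr.
by rewrite add0r pZ !integral_vec0 -!mulr2n aZ uZ.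
Qed.

Lemma glueP d : glued d (glue d).
Proof. exact: xgetPex (glued_total d). Qed.

Lemma glue_bij : bijective glue.
Proof.
have [f fP] := choice glued_surj; exists f => [d|e].
  exact: glued_inj (fP _) (glueP d).
exact: glued_fun (glueP _) (fP e).
Qed.

Lemma glueD : {morph glue : d e / d + e}.
Proof.
move=> d e; apply: glued_fun (glueP _) _.
have [x [y [-> -> xyZ]]] := glueP d; have [x' [y' [-> -> xyZ']]] := glueP e.
exists (x + x'), (y + y'); rewrite !disc_piD; split=> //=.
by rewrite embMD embND addrACA integral_vecD.
Qed.

Lemma glue_discform d : discform (glue d) = - discform d.
Proof.
have [x [y [-> -> xyZ]]] := glueP d; rewrite !discformE -[RHS]Quotient.pi_opp.
apply/eqP; rewrite piE Quotient.equivE opprK unfold_in.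
have := form_even latK3 xyZ.
rewrite !(bformDl, bformDr) embM_bform embN_bform (bformC _ (embN _)) embMN_bform.
by rewrite addr0 add0r addrC.
Qed.

(* b = glue o a o glue^-1, i.e. a and b are equal in O(D(M)) = O(D(N)). *)
Definition same_disc_isom (a : disc_isom latM) (b : disc_isom latN) : Prop :=
  forall d, b (glue d) = glue (a d).

Section PeriodDomain.
Variable C : numClosedFieldType.

Definition nonzero_vec n := set_type [set v : 'cV[C]_n | v != 0].

Section Projective.
Variable n : nat.

Definition collinear (v w : nonzero_vec n) : bool :=
  `[< exists c : C, val v = c *: val w >].

Lemma collinear_equiv : equiv_class_of collinear.
Proof.
have coll_sym v w : collinear v w -> collinear w v.
  move=> /asboolP[c vw]; apply/asboolP; exists c^-1.
  have c0 : c != 0.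
    apply/eqP => c0; move: (set_valP v).
    by rewrite /= vw c0 scale0r eqxx.
  by rewrite vw scalerA mulVf // scale1r.
split=> [v|v w|w v u].
- by apply/asboolP; exists 1; rewrite scale1r.
- by apply/idP/idP; exact: coll_sym.
- move=> /asboolP[c vw] /asboolP[d wu]; apply/asboolP; exists (c * d).
  by rewrite vw wu scalerA.
Qed.

Canonical collinear_equiv_rel := EquivRelPack collinear_equiv.
Canonical collinear_encModRel := defaultEncModRel collinear.

Definition proj_space := quotient_topology {eq_quot collinear}.
HB.instance Definition _ := Topological.on proj_space.

Lemma proj_eqP (v w : nonzero_vec n) :
  \pi_proj_space v = \pi_proj_space w <-> exists c : C, val v = c *: val w.
Proof.
split=> [/(@eqmodP _ collinear_equiv_rel)|vw]; first by move/asboolP.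
by apply/(@eqmodP _ collinear_equiv_rel)/asboolP.
Qed.

End Projective.

Variables (n : nat) (L : lattice n).

Definition conj_vec (w : 'cV[C]_n) : 'cV[C]_n := map_mx Num.conj w.

Definition period_domain : set (proj_space n) :=
  [set p | exists2 w : nonzero_vec n, p = \pi_(proj_space n) w &
     bform L (val w) (val w) = 0 /\ 0 < bform L (val w) (conj_vec (val w))].

Lemma nonzero_act_subproof (g : isometry L) (v : nonzero_vec n) :
  isom_act g (val v) \in [set v : 'cV[C]_n | v != 0].
Proof.
rewrite inE /=; apply/eqP => gv0; have := set_valP v => /=.
by rewrite -(isom_actK g (val v)) gv0 /isom_act mulmx0 eqxx.
Qed.

Definition nonzero_act (g : isometry L) (v : nonzero_vec n) : nonzero_vec n :=
  @exist _ (fun w => w \in _) _ (nonzero_act_subproof g v).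

Definition proj_act (g : isometry L) (p : proj_space n) : proj_space n :=
  \pi_(proj_space n) (nonzero_act g (repr p)).

Definition is_component (X : topologicalType) (A D : set X) : Prop :=
  exists2 x, A x & D = connected_component A x.

Definition isom_plus (D : set (proj_space n)) : set (isometry L) :=
  [set g | proj_act g @` D = D].

End PeriodDomain.

Definition primitive n (h : 'cV[int]_n) : Prop :=
  forall (k : int) (v : 'cV[int]_n), h = k *: v -> k \is a GRing.unit.

Definition isom_stab (h : 'cV[int]_(2 + 8)) : set (isometry latM) :=
  [set g | isom_act g h = h].

Definition Gamma (h : 'cV[int]_(2 + 8)) : set (isometry latN) :=
  [set g | exists2 f, isom_stab h f & same_disc_isom (disc_map f) (disc_map g)].

Definition conj_class (G : groupType) (K H : set G) : set (set G) :=
  [set H' | exists2 g, K g & H' = [set (x ^ g)%g | x in H]].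

Arguments period_domain C {n} L.
Arguments isom_plus {C n} L D.

(* Main.v *)
Require Import Defs.
From mathcomp Require Import all_boot all_order all_algebra.
From mathcomp Require Import boolp classical_sets functions cardinality reals.
From mathcomp Require Import topology normedtype complex.
From mathcomp Require Import ring lra zify.
From Stdlib Require BinNat.

(** The kernel of O(N) -> O(D(N)) lies in every group Gamma_h, and every element of
    O(D(N)) that comes from O(M) lifts to O^+(N): extend an isometry of M by the
    identity of U, and, should it exchange the two components of the period domain,
    compose it with id_U + (-id), which acts trivially on the 2-elementary group D(N)
    and exchanges them too ([isom_plus_lift], [plus_lift]). So the conjugacy class of
    Gamma_h^+ only depends on the image H_h of O(M, h) in O(D(M)), up to conjugacy.

    M(1/2) = U + E_8(-1) is the root lattice of E_10. Its fundamental chamber is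
    spanned by ten fundamental weights, all of positive norm but one that is
    isotropic. Up to sign and up to the Weyl group a vector h of positive norm is
    dominant ([dominant_conj]), and then O(M, h) is generated by the reflections in
    the simple roots orthogonal to h ([stabilizerE]). Thus the class of Gamma_h^+ only
    depends on a set J of simple roots, the walls of the face of h. The possible J are
    those which omit a node other than the end of the long arm of the diagram, whose
    weight is isotropic, and each occurs for a primitive h ([face_vec_primitive]).
    There are 1022 of them.

    If J lies in a larger set J + s of finite type, the longest elements of the two
    parabolic groups give an element of the Weyl group mapping J onto another set J'
    of simple roots, so that J and J' define the same class ([adjacent_face_class]).
    These moves connect the 1022 sets into 87 families.

    Conversely, conjugate classes have the same number of pairs (d, e) of elements of
    D(M) such that e lies in the H_h-orbit of d ([orbit_pairs_class]). As D(M)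
    is isomorphic to M/2M, it has 1024 elements, on which simple reflections act by
    changing one coordinate. So this number can be computed by exploring orbits
    ([computed_orbit_pairsP]); its values on the 87 families are pairwise distinct
    ([face_components_separated]). *)

Set Implicit Arguments.
Unset Strict Implicit.
Unset Printing Implicit Defensive.

Import Order.TTheory GRing.Theory Num.Theory.
Import numFieldNormedType.Exports.
Local Open Scope classical_set_scope.
Local Open Scope quotient_scope.
Local Open Scope card_scope.
Local Open Scope ring_scope.

Local Notation isometry := Defs.isometry.
Local Notation glue := Defs.glue.
Local Notation B := (@bform _ latMhalf int).

(** * The Hodge index theorem for U + E_8(-1) *)

(** Indexing by [nat] keeps the explicit formulas below free of the proof terms that
    ordinals carry. *)
Definition entry (K : comNzRingType) n (x : 'cV[K]_n) (k : nat) : K :=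
  oapp (fun i : 'I_n => x i 0) 0 (insub k).

Lemma entryE (K : comNzRingType) n (x : 'cV[K]_n) (i : 'I_n) : x i 0 = entry x i.
Proof. by rewrite /entry valK. Qed.

Lemma entry_lin (K : comNzRingType) n (a : K) (x y : 'cV[K]_n) k :
  entry (a *: x + y) k = a * entry x k + entry y k.
Proof. by rewrite /entry; case: insub => [i|] /=; rewrite ?mxE ?mulr0 ?addr0. Qed.

Lemma entryP (K : comNzRingType) n (x y : 'cV[K]_n) :
  (forall k, (k < n)%N -> entry x k = entry y k) -> x = y.
Proof. by move=> xy; apply/colP => i; rewrite !entryE xy. Qed.

Lemma entryB (K : comNzRingType) n (x y : 'cV[K]_n) k : entry (x - y) k = entry x k - entry y k.
Proof. by rewrite addrC -scaleN1r entry_lin mulN1r addrC. Qed.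

Lemma entry0 (K : comNzRingType) n k : entry (0 : 'cV[K]_n) k = 0.
Proof. by rewrite /entry; case: insub => [i|] //=; rewrite mxE. Qed.

Lemma entry_usub (K : comNzRingType) m n (x : 'cV[K]_(m + n)) (i : 'I_m) :
  usubmx x i 0 = entry x i.
Proof. by rewrite mxE entryE. Qed.

Lemma entry_dsub (K : comNzRingType) m n (x : 'cV[K]_(m + n)) (i : 'I_n) :
  dsubmx x i 0 = entry x (m + i).
Proof. by rewrite mxE entryE. Qed.

Definition E8_poly (K : comNzRingType) (u v : nat -> K) : K :=
  2 * (u 0%N * v 0%N + u 1%N * v 1%N + u 2%N * v 2%N + u 3%N * v 3%N
       + u 4%N * v 4%N + u 5%N * v 5%N + u 6%N * v 6%N + u 7%N * v 7%N)
  - (u 0%N * v 1%N + u 1%N * v 0%N + u 1%N * v 2%N + u 2%N * v 1%N + u 2%N * v 3%N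
     + u 3%N * v 2%N + u 3%N * v 4%N + u 4%N * v 3%N + u 4%N * v 5%N + u 5%N * v 4%N
     + u 5%N * v 6%N + u 6%N * v 5%N + u 2%N * v 7%N + u 7%N * v 2%N).

Lemma bform_hypU (K : comNzRingType) (x y : 'cV[K]_2) :
  bform hypU x y = entry x 0%N * entry y 1%N + entry x 1%N * entry y 0%N.
Proof.
rewrite /bform !mxE !big_ord_recl big_ord0 !mxE !big_ord_recl !big_ord0 !mxE !entryE /=.
by ring.
Qed.

Lemma bform_E8 (K : comNzRingType) (x y : 'cV[K]_8) :
  bform E8 x y = E8_poly (entry x) (entry y).
Proof.
rewrite /bform !mxE !big_ord_recl big_ord0 !mxE !big_ord_recl !big_ord0 !mxE !entryE /=.
by rewrite /E8_poly /bump /=; ring.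
Qed.

Lemma bform_latMhalfE (K : comNzRingType) (x y : 'cV[K]_(2 + 8)) :
  bform latMhalf x y = entry x 0%N * entry y 1%N + entry x 1%N * entry y 0%N
    - E8_poly (fun k => entry x (2 + k)) (fun k => entry y (2 + k)).
Proof.
have up (z : 'cV[K]_(2 + 8)) k : (k < 2)%N -> entry (usubmx z) k = entry z k.
  by move=> k2; rewrite -(entry_usub z (Ordinal k2)) entryE.
have dn (z : 'cV[K]_(2 + 8)) k : (k < 8)%N -> entry (dsubmx z) k = entry z (2 + k).
  by move=> k8; rewrite -(entry_dsub z (Ordinal k8)) entryE.
by rewrite bform_lsum bform_lscale bform_hypU bform_E8 /E8_poly !up // !dn //; ring.
Qed.

Section Hodge.
Variable K : realDomainType.
Implicit Types (u : nat -> K) (x y h : 'cV[K]_(2 + 8)).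

(** Completing the squares from the leaves of the Dynkin diagram towards its branch
    node. *)
Lemma E8_squares u :
  60 * E8_poly u u = 30 * (2 * u 0%N - u 1%N) ^+ 2 + 10 * (3 * u 1%N - 2 * u 2%N) ^+ 2
    + 30 * (2 * u 7%N - u 2%N) ^+ 2 + 30 * (2 * u 6%N - u 5%N) ^+ 2
    + 10 * (3 * u 5%N - 2 * u 4%N) ^+ 2 + 5 * (4 * u 4%N - 3 * u 3%N) ^+ 2
    + 3 * (5 * u 3%N - 4 * u 2%N) ^+ 2 + 2 * u 2%N ^+ 2.
Proof. by rewrite /E8_poly; ring. Qed.

Lemma E8_poly_ge0 u : 0 <= E8_poly u u.
Proof.
rewrite -(pmulr_rge0 _ (_ : 0 < 60)) // E8_squares.
by rewrite !addr_ge0 // mulr_ge0 // sqr_ge0.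
Qed.

Lemma E8_poly_eq0 u k : E8_poly u u = 0 -> (k < 8)%N -> u k = 0.
Proof.
move=> E0; have := E8_squares u; rewrite E0 mulr0.
have sq0 (a b c d e f g i : K) : 0 = 30 * a ^+ 2 + 10 * b ^+ 2 + 30 * c ^+ 2 + 30 * d ^+ 2
    + 10 * e ^+ 2 + 5 * f ^+ 2 + 3 * g ^+ 2 + 2 * i ^+ 2 ->
    [/\ a = 0, b = 0, c = 0, d = 0 & [/\ e = 0, f = 0, g = 0 & i = 0]].
  move: (sqr_ge0 a) (sqr_ge0 b) (sqr_ge0 c) (sqr_ge0 d) (sqr_ge0 e) (sqr_ge0 f)
    (sqr_ge0 g) (sqr_ge0 i) => *.
  by do !split; apply/eqP; rewrite -sqrf_eq0; apply/eqP; lra.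
move=> /sq0[e0 e1 e2 e3 [e4 e5 e6 e7]].
by case: k => [|[|[|[|[|[|[|[|//]]]]]]]] _; lra.
Qed.

(** Reversed Cauchy-Schwarz inequality: [y_0 x - x_0 y] has no first coordinate, so that
    only the definite part of the form contributes to its norm. *)
Lemma reverse_cauchy x y : entry y 0%N ^+ 2 * bform latMhalf x x +
  entry x 0%N ^+ 2 * bform latMhalf y y <= 2 * entry x 0%N * entry y 0%N * bform latMhalf x y.
Proof.
have := E8_poly_ge0 (fun k => entry y 0%N * entry x (2 + k) - entry x 0%N * entry y (2 + k)).
by rewrite !bform_latMhalfE /E8_poly; lra.
Qed.

(** The sign of the first coordinate, which is the product with an isotropic vector,
    therefore tells the two cones of vectors of positive norm apart. *)
Lemma positive_entry0_neq0 x : 0 < bform latMhalf x x -> entry x 0%N != 0.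
Proof.
rewrite bform_latMhalfE; apply: contraTneq => ->.
by have := E8_poly_ge0 (fun k => entry x (2 + k)); rewrite -leNgt; lra.
Qed.

Lemma cone_bform_gt0 x y : 0 < bform latMhalf x x -> 0 <= bform latMhalf y y ->
  0 < entry x 0%N -> 0 < entry y 0%N -> 0 < bform latMhalf x y.
Proof.
move=> xx yy x0 y0; have := reverse_cauchy x y.
rewrite -(pmulr_rgt0 _ (mulr_gt0 x0 y0)).
have : 0 < entry y 0%N ^+ 2 * bform latMhalf x x by rewrite mulr_gt0 ?exprn_gt0.
have : 0 <= entry x 0%N ^+ 2 * bform latMhalf y y by rewrite mulr_ge0 ?sqr_ge0.
set p := _ * bform _ _ _; set q := _ * bform _ _ _.
by move=> *; rewrite -(pmulr_rgt0 _ (_ : 0 < 2)) //; lra.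
Qed.

Lemma isotropic_perp_le0 x : entry x 0%N = 0 -> bform latMhalf x x <= 0.
Proof.
move=> x0; rewrite bform_latMhalfE x0.
by have := E8_poly_ge0 (fun k => entry x (2 + k)); lra.
Qed.

(** If [x] had nonnegative norm, the reversed Cauchy-Schwarz inequality would make both
    of its terms vanish, hence the first coordinate and the norm of [x], and then its
    E_8-component. *)
Lemma hodge_index h x : 0 < bform latMhalf h h -> bform latMhalf h x = 0 ->
  x != 0 -> bform latMhalf x x < 0.
Proof.
move=> hh hx; apply: contraNT; rewrite -leNgt => xx; apply/eqP.
have h0 := positive_entry0_neq0 hh.
have h02 : 0 < entry h 0%N ^+ 2 by rewrite exprn_even_gt0.
have := reverse_cauchy h x; rewrite hx mulr0.
have : 0 <= entry x 0%N ^+ 2 * bform latMhalf h h by rewrite mulr_ge0 ?sqr_ge0 ?ltW.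
have : 0 <= entry h 0%N ^+ 2 * bform latMhalf x x by rewrite mulr_ge0 ?sqr_ge0.
move=> p q r.
have /eqP : entry x 0%N ^+ 2 * bform latMhalf h h = 0 by lra.
rewrite mulf_eq0 (gt_eqF hh) orbF sqrf_eq0 => /eqP x0.
have /eqP : entry h 0%N ^+ 2 * bform latMhalf x x = 0 by lra.
rewrite mulf_eq0 (gt_eqF h02) /= => /eqP xx0.
have E0 : E8_poly (fun k => entry x (2 + k)) (fun k => entry x (2 + k)) = 0.
  by move: xx0; rewrite bform_latMhalfE x0; lra.
have xE k : (k < 8)%N -> entry x (2 + k) = 0 := E8_poly_eq0 E0.
have /eqP : entry h 0%N * entry x 1%N = 0.
  move: hx; rewrite bform_latMhalfE x0 /E8_poly !xE //; lra.
rewrite mulf_eq0 (negPf h0) => /eqP x1.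
apply: entryP => -[|[|k]] k10; rewrite entry0 ?x0 ?x1 //; exact: xE.
Qed.
End Hodge.

(** * Simple roots, fundamental weights and roots of E_10 *)

Section FormSums.
Variables (n : nat) (L : lattice n) (K : comNzRingType).
Implicit Types x y : 'cV[K]_n.

Lemma bformZl a x y : bform L (a *: x) y = a * bform L x y.
Proof. by rewrite /bform linearZ /= -!scalemxAl mxE. Qed.

Lemma bformZr a x y : bform L x (a *: y) = a * bform L x y.
Proof. by rewrite bformC bformZl bformC. Qed.

Lemma bform_suml (I : Type) (r : seq I) (P : pred I) (F : I -> 'cV[K]_n) y :
  bform L (\sum_(i <- r | P i) F i) y = \sum_(i <- r | P i) bform L (F i) y.
Proof.
by rewrite (big_morph (fun x => bform L x y) (fun u v => bformDl L u v y) (bform0l L y)).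
Qed.

Lemma bform_sumr (I : Type) (r : seq I) (P : pred I) (F : I -> 'cV[K]_n) y :
  bform L y (\sum_(i <- r | P i) F i) = \sum_(i <- r | P i) bform L y (F i).
Proof. by rewrite bformC bform_suml; apply: eq_bigr => i _; rewrite bformC. Qed.

End FormSums.

Lemma bform_even (x : 'cV[int]_(2 + 8)) : exists z, B x x = 2 * z.
Proof.
rewrite bform_latMhalfE /E8_poly; set u := fun k => entry x (2 + k).
exists (entry x 0%N * entry x 1%N - (u 0%N * u 0%N + u 1%N * u 1%N + u 2%N * u 2%N + u 3%N * u 3%N
  + u 4%N * u 4%N + u 5%N * u 5%N + u 6%N * u 6%N + u 7%N * u 7%N
  - (u 0%N * u 1%N + u 1%N * u 2%N + u 2%N * u 3%N + u 3%N * u 4%N + u 4%N * u 5%N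
     + u 5%N * u 6%N + u 2%N * u 7%N))).
by ring.
Qed.

Definition vec10 (s : seq int) : 'cV[int]_(2 + 8) := \col_i s`_i.

(** Nodes 0 to 7 are those of E_8; node 8 is [f - theta] with [theta] the highest root
    of E_8, and node 9 is [e - f], where [e, f] is the standard basis of U. *)
Definition root_list (i : nat) : seq int :=
  if i == 9%N then [:: 1; -1]
   else if i == 8%N then [:: 0; 1; -2; -4; -6; -5; -4; -3; -2; -3]
   else 0 :: 0 :: mkseq (fun k => (k == i)%:R) 8.

Definition simple_root i := vec10 (root_list i).

(** The basis dual to the simple roots: [theta_i (e + f)] minus the i-th fundamental
    weight of E_8 for i < 8, where [theta_i] is the i-th coefficient of [theta],
    followed by [e + f] and by the isotropic vector [f]. *)
Definition weight_list (i : nat) : seq int :=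
  nth [::] [:: [:: 2; 2; -4; -7; -10; -8; -6; -4; -2; -5];
    [:: 4; 4; -7; -14; -20; -16; -12; -8; -4; -10];
    [:: 6; 6; -10; -20; -30; -24; -18; -12; -6; -15];
    [:: 5; 5; -8; -16; -24; -20; -15; -10; -5; -12];
    [:: 4; 4; -6; -12; -18; -15; -12; -8; -4; -9];
    [:: 3; 3; -4; -8; -12; -10; -8; -6; -3; -6];
    [:: 2; 2; -2; -4; -6; -5; -4; -3; -2; -3];
    [:: 3; 3; -5; -10; -15; -12; -9; -6; -3; -8];
    [:: 1; 1]; [:: 0; 1]] i.

Definition fund_weight i := vec10 (weight_list i).

(** The diagram is the chain 0 - 1 - ... - 6 - 8 - 9 with node 7 attached to node 2. *)
Definition dynkin_nbrs : seq (seq nat) :=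
  [:: [:: 1]; [:: 0; 2]; [:: 1; 3; 7]; [:: 2; 4]; [:: 3; 5]; [:: 4; 6]; [:: 5; 8];
      [:: 2]; [:: 6; 9]; [:: 8]]%N.

Definition root_gram (i j : nat) : int :=
  if i == j then -2 else (j \in nth [::] dynkin_nbrs i)%:R.

Lemma entry_vec10 s k : (k < 10)%N -> entry (vec10 s) k = s`_k.
Proof. by move=> k10; rewrite -(entryE _ (Ordinal k10 : 'I_(2 + 8))) mxE. Qed.

Definition list_form (s t : seq int) : int :=
  s`_0 * t`_1 + s`_1 * t`_0 - E8_poly (nth 0 (drop 2 s)) (nth 0 (drop 2 t)).

Lemma bform_vec10 s t : B (vec10 s) (vec10 t) = list_form s t.
Proof.
rewrite bform_latMhalfE !entry_vec10 // /list_form; congr (_ - _).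
by rewrite /E8_poly !entry_vec10 // !nth_drop.
Qed.

Lemma forall_lt10 (P : pred nat) : all P (iota 0 10) -> forall i, (i < 10)%N -> P i.
Proof. by move=> /allP PP i i10; apply: PP; rewrite mem_iota. Qed.

Lemma forall_lt10x10 (P : nat -> pred nat) : all (fun i => all (P i) (iota 0 10)) (iota 0 10) ->
  forall i j, (i < 10)%N -> (j < 10)%N -> P i j.
Proof. by move=> /forall_lt10 PP i j /PP /forall_lt10; apply. Qed.

Lemma bform_roots i j : (i < 10)%N -> (j < 10)%N ->
  B (simple_root i) (simple_root j) = root_gram i j.
Proof.
move=> i10 j10; rewrite bform_vec10; apply/eqP; move: i j i10 j10.
by apply: forall_lt10x10; vm_compute.
Qed.

Lemma bform_root_weight i j : (i < 10)%N -> (j < 10)%N ->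
  B (simple_root i) (fund_weight j) = (i == j)%:R.
Proof.
move=> i10 j10; rewrite bform_vec10; apply/eqP; move: i j i10 j10.
by apply: forall_lt10x10; vm_compute.
Qed.

Lemma bform_weights_ge0 i j : (i < 10)%N -> (j < 10)%N ->
  0 <= B (fund_weight i) (fund_weight j).
Proof.
move=> i10 j10; rewrite bform_vec10; move: i j i10 j10.
by apply: forall_lt10x10; vm_compute.
Qed.

Lemma bform_weight_gt0 i : (i < 9)%N -> 0 < B (fund_weight i) (fund_weight i).
Proof.
move=> i9; rewrite bform_vec10; apply: (implyP _ i9).
by move: {i9} i (leqW i9); apply: forall_lt10; vm_compute.
Qed.

(** It has product 1 with all simple roots, so that its product with a vector is the sum
    of the coefficients of that vector on the simple roots, which is called the height
    below. *)
Definition weyl_vector : 'cV[int]_(2 + 8) := \sum_(i < 10) fund_weight i.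

Lemma weyl_root i : (i < 10)%N -> B weyl_vector (simple_root i) = 1.
Proof.
move=> i10; rewrite bform_suml (bigD1 (Ordinal i10)) //= bformC bform_root_weight //.
rewrite eqxx big1 ?addr0 // => j /eqP ji; rewrite bformC bform_root_weight //.
by case: eqP => // ij; case: ji; apply: val_inj.
Qed.

(** Pairwise distinct and positive, which is what rules out diagram automorphisms below. *)
Definition weyl_coef (i : nat) : int :=
  nth 0 [:: 76; 153; 231; 195; 160; 126; 93; 115; 61; 30] i.

Lemma weyl_weight i : (i < 10)%N -> B weyl_vector (fund_weight i) = weyl_coef i.
Proof.
move=> i10; rewrite bform_suml; under eq_bigr do rewrite bform_vec10.
by rewrite !big_ord_recl big_ord0; apply/eqP; move: i i10; apply: forall_lt10; vm_compute.
Qed.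

Lemma weyl_coef_gt0 i : (i < 10)%N -> 0 < weyl_coef i.
Proof. by move: i; apply: forall_lt10. Qed.

Lemma weyl_coef_inj i j : (i < 10)%N -> (j < 10)%N -> weyl_coef i = weyl_coef j -> i = j.
Proof.
move=> i10 j10 /eqP ij; apply/eqP/(implyP _ ij) => {ij}; move: i j i10 j10.
by apply: forall_lt10x10; vm_compute.
Qed.

(** Turns matrix identities such as [W^T G P = 1] into values of the form on columns. *)
Lemma form_entry (R : pzRingType) n (W G P : 'M[R]_n) i j :
  ((col i W)^T *m G *m col j P) 0 0 = (W^T *m G *m P) i j.
Proof. by rewrite tr_col -row_mul colE mulmxA -row_mul -colE !mxE. Qed.

(** Duality says [W^T G P = 1] for the matrices [P] of simple roots and [W] of weights,
    and one-sided inverses of square matrices are two-sided. *)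
Lemma root_expansion x : x = \sum_(i < 10) B x (fund_weight i) *: simple_root i.
Proof.
pose P : 'M[int]_(2 + 8) := \matrix_(k, i) simple_root i k 0.
pose W : 'M[int]_(2 + 8) := \matrix_(k, i) fund_weight i k 0.
have Wcol (i : 'I_(2 + 8)) : col i W = fund_weight i by apply/colP => k; rewrite !mxE.
have Pcol (i : 'I_(2 + 8)) : col i P = simple_root i by apply/colP => k; rewrite !mxE.
have gram1 : map_mx intr (gram latMhalf) = gram latMhalf :> 'M[int]_(2 + 8).
  by apply/matrixP => i j; rewrite mxE intz.
have BE u v : (u^T *m gram latMhalf *m v) 0 0 = B u v by rewrite /bform gram1.
have WP : W^T *m gram latMhalf *m P = 1%:M.
  apply/matrixP => i j; rewrite [RHS]mxE -val_eqE eq_sym /= -form_entry Wcol Pcol.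
  by rewrite BE bformC bform_root_weight.
have {}WP := mulmx1C WP.
apply/colP => k; rewrite -[x in LHS]mul1mx -WP -mulmxA mxE summxE.
apply: eq_bigr => i _; rewrite mxE [RHS]mxE mulrC; congr (_ * _).
rewrite bformC -BE -Wcol tr_col -!row_mul.
by rewrite [RHS]mxE.
Qed.

Lemma coef_inj y z :
  (forall i, (i < 10)%N -> B y (fund_weight i) = B z (fund_weight i)) -> y = z.
Proof.
move=> yz; rewrite (root_expansion y) (root_expansion z).
by apply: eq_bigr => i _; rewrite yz.
Qed.

Lemma weight_expansion x : x = \sum_(i < 10) B x (simple_root i) *: fund_weight i.
Proof.
apply: coef_inj => j j10; rewrite bform_suml [in LHS](root_expansion (fund_weight j)) bform_sumr.
by apply: eq_bigr => i _; rewrite bformZr bformZl mulrC (bformC _ (fund_weight i)).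
Qed.

Lemma bform_expansion x y :
  B x y = \sum_(i < 10) B x (simple_root i) * B y (fund_weight i).
Proof.
rewrite [in LHS](root_expansion y) bform_sumr; apply: eq_bigr => i _.
by rewrite bformZr mulrC.
Qed.

(** A vector of negative norm has norm at most -2 because the lattice is even. *)
Lemma hodge_index_int i x : (i < 9)%N -> B x (fund_weight i) = 0 -> x != 0 -> B x x <= -2.
Proof.
move=> i9; rewrite bformC => /(hodge_index (bform_weight_gt0 i9)) H /H.
have [z ->] := bform_even x; lia.
Qed.

Lemma entry0_weight x : entry x 0%N = B x (fund_weight 9).
Proof. by rewrite bform_latMhalfE !entry_vec10 // /E8_poly !entry_vec10 //=; ring. Qed.

Lemma weight_perp_le0 i x : (i < 10)%N -> B x (fund_weight i) = 0 -> B x x <= 0.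
Proof.
move=> i10 xi; have [->|x0] := eqVneq x 0; first by rewrite bform0l.
have [i9|i9] := ltnP i 9; first by have := hodge_index_int i9 xi x0; lia.
have {i9 i10} i9 : i = 9%N by lia.
by move: xi; rewrite {}i9 -entry0_weight => /isotropic_perp_le0.
Qed.

(** Such an [r] would be a difference [p - n] of nonzero nonnegative combinations of
    disjoint sets of simple roots, whence (p, n) >= 0 and (p, p) + (n, n) = -2 + 2 (p,
    n). But [p] is orthogonal to the i-th weight and [n] to the j-th one, so that the
    Hodge index theorem makes both norms at most -2, which is a contradiction. The only
    exception is that [p] may have norm 0 if it is orthogonal to the isotropic weight
    alone; then [n] is a multiple of the last simple root and [p] involves its
    neighbour, so that (p, n) >= 1. *)
Lemma root_no_mixed_sign r i j : B r r = -2 -> (i < 10)%N -> (j < 9)%N ->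
  B r (fund_weight i) < 0 -> B r (fund_weight j) > 0 -> False.
Proof.
move=> rr i10 j9 ri rj; set c := fun k => B r (fund_weight k).
(* The decomposition of [r] into its positive and negative parts. *)
pose p := \sum_(k < 10 | 0 < c k) c k *: simple_root k.
pose n := \sum_(k < 10 | ~~ (0 < c k)) (- c k) *: simple_root k.
have rE : r = p - n.
  rewrite [LHS]root_expansion (bigID (fun k : 'I_10 => 0 < c k)) /=; congr (_ + _).
  by rewrite -sumrN; apply: eq_bigr => k _; rewrite scaleNr opprK.
have pE k : (k < 10)%N -> B p (fund_weight k) = if 0 < c k then c k else 0.
  move=> k10; rewrite bform_suml.
  rewrite (eq_bigr (fun m : 'I_10 => if val m == k then c k else 0)); last first.
    by move=> m _; rewrite bformZl bform_root_weight //; case: eqP => [->|]; rewrite ?mulr1 ?mulr0.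
  rewrite -big_mkcondr; case: ifP => ck.
    rewrite (big_pred1 (Ordinal k10)) // => m /=; rewrite -val_eqE /=.
    by case: eqP => [->|]; rewrite ?ck ?andbF.
  by rewrite big1 // => m /andP[cm /eqP mk]; rewrite mk ck in cm.
have nE k : (k < 10)%N -> B n (fund_weight k) = if 0 < c k then 0 else - c k.
  move=> k10; have -> : n = p - r by rewrite rE subKr.
  by rewrite bformDl bformNl pE // -/(c k); case: ifP; rewrite ?subrr ?sub0r.
have pn0 (k m : 'I_10) : 0 < c k -> ~~ (0 < c m) ->
    0 <= c k * (- c m * B (simple_root k) (simple_root m)).
  move=> ck cm; rewrite bform_roots // /root_gram; case: eqP => [km|_].
    by rewrite km (negPf cm) in ck.
  by rewrite mulr_ge0 ?(ltW ck) // mulr_ge0 ?ler0n // oppr_ge0 leNgt.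
have pn : B p n = \sum_(k < 10 | 0 < c k) \sum_(m < 10 | ~~ (0 < c m))
    c k * (- c m * B (simple_root k) (simple_root m)).
  rewrite bform_suml; apply: eq_bigr => k _; rewrite bformZl bform_sumr mulr_sumr.
  by apply: eq_bigr => m _; rewrite bformZr.
have pn_ge0 : 0 <= B p n by rewrite pn sumr_ge0 // => k ck; rewrite sumr_ge0 // => m; apply: pn0.
have rr2 : B p p + B n n - 2 * B p n = -2.
  by rewrite -rr rE !(bformDl, bformDr, bformNl, bformNr) (bformC _ n p); ring.
have pi : B p (fund_weight i) = 0 by rewrite pE // ltNge ltW.
have nj : B n (fund_weight j) = 0 by rewrite nE ?rj // leqW.
have p0 : p != 0.
  apply/eqP => p0; have cj : 0 < c j := rj.
  by have := pE j (leqW j9); rewrite p0 bform0l cj; lia.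
have n0 : n != 0.
  apply/eqP => n0; have ci : c i < 0 := ri.
  by have := nE i i10; rewrite n0 bform0l ltNge ltW //=; lia.
have nn := hodge_index_int j9 nj n0.
have pp := weight_perp_le0 i10 pi.
have [/existsP[k /andP[k9 ck]]|/existsPn neg] :=
    boolP [exists k : 'I_10, (k < 9)%N && ~~ (0 < c k)].
  have pk : B p (fund_weight k) = 0 by rewrite pE // (negPf ck).
  by have := hodge_index_int k9 pk p0; lia.
have cpos k : (k < 9)%N -> 0 < c k.
  by move=> k9; have := neg (Ordinal (leqW k9)); rewrite /= k9 negbK.
(* The exceptional case: [p] involves all simple roots but the last one. *)
have i9 : i = 9%N.
  have [i9|] := ltnP i 9; last lia.
  by have := cpos _ i9; rewrite ltNge /c ltW.
have : 1 <= B p n.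
  rewrite pn (bigD1 (Ordinal (isT : 8 < 10)%N)) ?cpos //= -[1]addr0 lerD //; last first.
    by rewrite sumr_ge0 // => k /andP[ck _]; rewrite sumr_ge0 // => m; apply: pn0.
  have c9 : ~~ (0 < c 9%N) by rewrite -i9 -leNgt ltW.
  rewrite (bigD1 (Ordinal (isT : 9 < 10)%N)) //= -[1]addr0 lerD //.
    have := cpos 8%N isT; have : c 9%N < 0 by rewrite -i9.
    rewrite bform_roots // /root_gram /= mulr1; nia.
  rewrite sumr_ge0 // => m /andP[cm _].
  by apply: (pn0 (Ordinal (isT : 8 < 10)%N)) => //; apply: cpos.
lia.
Qed.

Lemma root_sign r : B r r = -2 ->
  (forall i, (i < 10)%N -> 0 <= B r (fund_weight i)) \/
  (forall i, (i < 10)%N -> B r (fund_weight i) <= 0).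
Proof.
move=> rr; apply: contrapT => /not_orP[/existsNP[i /not_implyP[i10 /negP ri]]].
move=> /existsNP[j /not_implyP[j10 /negP rj]]; rewrite -!ltNge in ri rj.
have [j9|j9] := ltnP j 9; first exact: root_no_mixed_sign rr i10 j9 ri rj.
have i9 : (i < 9)%N.
  have [//|i9] := ltnP i 9; have ij : i = j by lia.
  by move: ri; rewrite ij ltNge ltW.
apply: (@root_no_mixed_sign (- r) j i); rewrite // ?bformNl ?bformNr ?opprK //.
  by rewrite oppr_lt0.
by rewrite oppr_gt0.
Qed.

(** * Weyl chambers and stabilizers *)

Section Action.
Variables (n : nat) (L : lattice n) (K : comNzRingType).
Implicit Types (g h : isometry L) (x : 'cV[K]_n).

Lemma isom_actM g h x : isom_act (g * h)%g x = isom_act g (isom_act h x).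
Proof. by rewrite /isom_act map_mxM mulmxA. Qed.

Lemma isom_act1 x : isom_act (1%g : isometry L) x = x.
Proof. by rewrite /isom_act /= map_mx1 mul1mx. Qed.

Lemma isom_actZ g a x : isom_act g (a *: x) = a *: isom_act g x.
Proof. by rewrite /isom_act -scalemxAr. Qed.

Lemma isom_actD g x y : isom_act g (x + y) = isom_act g x + isom_act g y.
Proof. exact: mulmxDr. Qed.

Lemma isom_actN g x : isom_act g (- x) = - isom_act g x.
Proof. exact: mulmxN. Qed.

Lemma isom_act_inj g : injective (@isom_act _ L K g).
Proof. exact: can_inj (isom_actK g). Qed.

Lemma isom_act_sum (I : Type) (r : seq I) (P : pred I) (F : I -> 'cV[K]_n) g :
  isom_act g (\sum_(i <- r | P i) F i) = \sum_(i <- r | P i) isom_act g (F i).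
Proof. exact: mulmx_sumr. Qed.

End Action.

Lemma map_intr_int m n (x : 'M[int]_(m, n)) : map_mx intr x = x.
Proof. by apply/matrixP => i j; rewrite mxE intz. Qed.

Lemma isom_act_ext n (L : lattice n) (g h : isometry L) :
  (forall x : 'cV[int]_n, isom_act g x = isom_act h x) -> g = h.
Proof.
move=> gh; apply/val_inj/matrixP => i j.
have /colP/(_ i) := gh (delta_mx j 0).
by rewrite /isom_act -!colE !mxE !intz.
Qed.

Lemma latM_form_act (K : numDomainType) (g : isometry latM) (x y : 'cV[K]_(2 + 8)) :
  bform latMhalf (isom_act g x) (isom_act g y) = bform latMhalf x y.
Proof.
by apply: (mulfI (_ : 2 != 0)); rewrite ?pnatr_eq0 // -!bform_latM isom_act_form.
Qed.

Lemma bform_act_inv (K : numDomainType) (g : isometry latM) (x y : 'cV[K]_(2 + 8)) :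
  bform latMhalf (isom_act g x) y = bform latMhalf x (isom_act g^-1%g y).
Proof. by rewrite -(latM_form_act g^-1%g) isom_actK. Qed.

(** Reduces the matrix identity defining isometries to a computation with vectors. *)
Lemma isometryP n (L : lattice n) (M : 'M[int]_n) :
  (forall x y : 'cV[int]_n, bform L (M *m x) (M *m y) = bform L x y) ->
  M^T *m gram L *m M == gram L.
Proof.
move=> MP; apply/eqP/matrixP => i j.
have gram1 : map_mx intr (gram L) = gram L by apply/matrixP => k l; rewrite mxE intz.
have dE k : delta_mx k 0 = col k 1%:M :> 'cV[int]_n by rewrite colE mul1mx.
have := MP (delta_mx i 0) (delta_mx j 0).
by rewrite -!colE !dE /bform gram1 !form_entry trmx1 mul1mx mulmx1.
Qed.

Section Reflections.
Implicit Types r : 'cV[int]_(2 + 8).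

(** For a root [r] of norm -2 this is x |-> x + (r, x) r. *)
Definition reflection_mx r : 'M[int]_(2 + 8) := 1%:M + r *m (r^T *m gram latMhalf).

Lemma reflection_mxE (K : comNzRingType) r (x : 'cV[K]_(2 + 8)) :
  map_mx intr (reflection_mx r) *m x =
  x + bform latMhalf (map_mx intr r) x *: map_mx intr r.
Proof.
rewrite map_mxD map_mx1 mulmxDl mul1mx !map_mxM -!mulmxA; congr (_ + _).
rewrite /bform -map_trmx -mulmxA.
set u := _ *m (_ *m x).
by apply/colP => i; rewrite mxE big_ord1 [RHS]mxE mulrC.
Qed.

Lemma reflection_isom (i : 'I_10) : (reflection_mx (simple_root i) \in unitmx) &&
  ((reflection_mx (simple_root i))^T *m gram latM *m reflection_mx (simple_root i)
   == gram latM).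
Proof.
set r := simple_root i; set s := reflection_mx r.
have rr : B r r = -2 by rewrite bform_roots // /root_gram eqxx.
have sE (x : 'cV[int]_(2 + 8)) : s *m x = x + B r x *: r.
  by have := reflection_mxE r x; rewrite !map_intr_int.
(* The matrix is an involution, hence invertible. *)
have ss : s *m s = 1%:M.
  apply/matrixP => j k; have := sE (s *m delta_mx k 0).
  rewrite [in RHS]sE bformDr bformZr rr -addrA -scalerDl.
  set b := B r _; rewrite (_ : b + (b + b * -2) = 0); last by ring.
  by rewrite scale0r addr0 mulmxA -colE => /colP/(_ j); rewrite !mxE eqxx andbT.
apply/andP; split; first exact: (mulmx1_unit ss).1.
apply: isometryP => x y.
rewrite !bform_latM !sE !(bformDl, bformDr, bformZl, bformZr) rr (bformC _ x r).
by ring.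
Qed.

Definition simple_reflection i : isometry latM := Isometry (reflection_isom i).

Lemma simple_reflectionE (K : comNzRingType) i (x : 'cV[K]_(2 + 8)) :
  isom_act (simple_reflection i) x =
  x + bform latMhalf (map_mx intr (simple_root i)) x *: map_mx intr (simple_root i).
Proof. exact: reflection_mxE. Qed.

Lemma simple_reflection_int i (x : 'cV[int]_(2 + 8)) :
  isom_act (simple_reflection i) x = x + B (simple_root i) x *: simple_root i.
Proof. by rewrite simple_reflectionE map_intr_int. Qed.

Lemma simple_reflectionV i : (simple_reflection i)^-1%g = simple_reflection i.
Proof.
have H : (simple_reflection i * simple_reflection i)%g = 1%g.
  apply: isom_act_ext => x; rewrite isom_actM isom_act1 !simple_reflection_int.
  rewrite bformDr bformZr bform_roots // /root_gram eqxx -addrA -scalerDl.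
  by set b := B _ x; rewrite (_ : b + (b + b * -2) = 0) ?scale0r ?addr0 //; ring.
by rewrite -[RHS]mul1g -(mulVg (simple_reflection i)) -mulgA H mulg1.
Qed.

Lemma simple_reflection_conj (g : isometry latM) (i j : 'I_10) :
  isom_act g (simple_root i) = simple_root j ->
  (g * simple_reflection i * g^-1)%g = simple_reflection j.
Proof.
move=> gij; apply: isom_act_ext => x; rewrite !isom_actM !simple_reflection_int.
by rewrite isom_actD isom_actZ isom_actVK gij -bform_act_inv gij.
Qed.

End Reflections.

(** The subgroup of the Weyl group generated by the simple reflections indexed by [J];
    words are recorded by sequences, which allows induction on them. *)
Definition parabolic (J : pred nat) (g : isometry latM) : Prop :=
  exists2 s : seq 'I_10, all (fun i : 'I_10 => J i) s &
    g = (\prod_(i <- s) simple_reflection i)%g.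

Definition dominant (h : 'cV[int]_(2 + 8)) :=
  (0 < B h h) /\ (forall i, (i < 10)%N -> 0 <= B h (simple_root i)).

Definition walls (h : 'cV[int]_(2 + 8)) : pred nat := fun i => B h (simple_root i) == 0.

(** All products of fundamental weights are nonnegative. *)
Lemma bform_dominant x y : (forall j, (j < 10)%N -> 0 <= B x (simple_root j)) ->
  (forall j, (j < 10)%N -> 0 <= B y (simple_root j)) -> 0 <= B x y.
Proof.
move=> xd yd; rewrite (weight_expansion x) (weight_expansion y) bform_suml.
rewrite sumr_ge0 // => i _; rewrite bform_sumr sumr_ge0 // => j _.
by rewrite bformZl bformZr !mulr_ge0 ?xd ?yd ?bform_weights_ge0.
Qed.

Lemma weight_dominant i j : (i < 10)%N -> (j < 10)%N ->
  0 <= B (fund_weight i) (simple_root j).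
Proof. by move=> i10 j10; rewrite bformC bform_root_weight // ler0n. Qed.

Lemma weyl_dominant j : (j < 10)%N -> 0 <= B weyl_vector (simple_root j).
Proof. by move=> j10; rewrite weyl_root. Qed.

Lemma dominant_crd0 h : dominant h -> 0 < entry h 0%N.
Proof.
case=> hh hd; rewrite lt0r positive_entry0_neq0 //= entry0_weight.
by apply: bform_dominant => // j; apply: weight_dominant.
Qed.

Lemma weyl_norm_gt0 : 0 < B weyl_vector weyl_vector.
Proof.
rewrite bform_sumr big_ord_recl ltr_pwDl ?weyl_weight //.
by apply: sumr_ge0 => i _; rewrite weyl_weight ?ltW ?weyl_coef_gt0 // /bump /= add1n.
Qed.

Lemma weyl_crd0 : 0 < entry weyl_vector 0%N.
Proof. by apply: dominant_crd0; split; [exact: weyl_norm_gt0|exact: weyl_dominant]. Qed.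

(** Vectors of positive norm with positive product lie in the same cone. *)
Lemma cone_of_form h x : 0 < B h h -> 0 < B x x -> 0 < entry h 0%N -> 0 < B x h ->
  0 < entry x 0%N.
Proof.
move=> hh xx h0 xh; have := positive_entry0_neq0 xx; rewrite neq_lt => /orP[x0|//].
have := @cone_bform_gt0 _ h (- x) hh; rewrite bformNl !bformNr opprK => /(_ (ltW xx) h0).
rewrite -[- x]sub0r entryB entry0 sub0r oppr_gt0 x0 oppr_gt0 => /(_ isT).
by rewrite bformC ltNge ltW.
Qed.

Lemma bform_weyl_expansion x : B weyl_vector x = \sum_(i < 10) B x (fund_weight i).
Proof. by rewrite bform_expansion; apply: eq_bigr => i _; rewrite weyl_root // mul1r. Qed.

Lemma root_act_norm (g : isometry latM) (i : nat) : (i < 10)%N ->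
  B (isom_act g (simple_root i)) (isom_act g (simple_root i)) = -2.
Proof. by move=> i10; rewrite latM_form_act bform_roots // /root_gram eqxx. Qed.

(** The height of [r] is the sum of its coefficients. *)
Lemma root_height_gt0 r : B r r = -2 -> (forall i, (i < 10)%N -> 0 <= B r (fund_weight i)) ->
  0 < B weyl_vector r.
Proof.
move=> rr rpos; rewrite bform_weyl_expansion lt0r sumr_ge0 ?andbT => [|i _]; last exact: rpos.
apply/eqP => /eqP; rewrite psumr_eq0 => [/allP r0|i _]; last exact: rpos.
suff r_0 : r = 0 by move: rr; rewrite r_0 bform0l.
rewrite [r]root_expansion big1 // => i _.
by have := r0 i (mem_index_enum _) => /eqP ->; rewrite scale0r.
Qed.

(** An isometry [g] mapping all simple roots to positive roots maps no simple root to a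
    root of height less than 1, so that [g^-1] maps the Weyl vector [rho] to [rho + d]
    with [d] dominant. Comparing norms gives [d = 0]. Hence [g] preserves heights and
    permutes the simple roots, and so the coefficients of [rho], which are pairwise
    distinct. *)
Lemma positive_isom_trivial (g : isometry latM) :
  (forall i, (i < 10)%N -> 0 < B weyl_vector (isom_act g (simple_root i))) -> g = 1%g.
Proof.
move=> gpos; pose rho : 'cV[int]_(2 + 8) := weyl_vector.
pose d : 'cV[int]_(2 + 8) := isom_act g^-1%g rho - rho.
have rootg i : (i < 10)%N -> B (isom_act g^-1%g rho) (simple_root i) =
    B rho (isom_act g (simple_root i)).
  by move=> i10; rewrite bform_act_inv invgK.
have dd i : (i < 10)%N -> 0 <= B d (simple_root i).
  move=> i10; have := gpos _ i10; rewrite -/rho bformDl bformNl rootg // weyl_root //; lia.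
have d_norm : 2 * B rho d + B d d = 0.
  have := latM_form_act g^-1%g rho rho.
  rewrite (_ : isom_act _ rho = rho + d); last by rewrite addrC subrK.
  move: (d) => e; rewrite !(bformDl, bformDr) (bformC _ e rho).
  by move: (B rho e) (B e e) (B rho rho) => a b c; lia.
have rd : 0 <= B rho d by apply: bform_dominant => //; exact: weyl_dominant.
have dd0 : 0 <= B d d by exact: bform_dominant.
have {rd dd0 d_norm} /eqP : B rho d = 0 by lia.
rewrite bformC bform_expansion psumr_eq0 => [/allP dw|i _]; last first.
  by rewrite mulr_ge0 ?dd // weyl_weight // ltW // weyl_coef_gt0.
have d0 : d = 0.
  rewrite [d]weight_expansion big1 // => i _.
  have /eqP := dw i (mem_index_enum _); rewrite /= weyl_weight //.
  by move=> /eqP; rewrite mulf_eq0 (gt_eqF (weyl_coef_gt0 _)) // orbF => /eqP ->; rewrite scale0r.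
have grho : isom_act g^-1%g rho = rho by apply/eqP; rewrite -subr_eq0 -/d d0.
(* A positive root of height 1 is simple. *)
have img (i : 'I_10) : exists j : 'I_10, isom_act g (simple_root i) == simple_root j.
  set r := isom_act g _; have rr : B r r = -2 by exact: root_act_norm.
  have r1 : B rho r = 1 by rewrite -rootg // grho weyl_root.
  have rpos k : (k < 10)%N -> 0 <= B r (fund_weight k).
    case: (root_sign rr) k => // rneg; move: r1; rewrite bform_weyl_expansion => r1.
    have : \sum_(k < 10) B r (fund_weight k) <= 0 by apply: sumr_le0 => k _; exact: rneg.
    by rewrite r1.
  have [j rj] : exists j : 'I_10, 0 < B r (fund_weight j).
    apply: contrapT => /forallNP rnp; move: r1; rewrite bform_weyl_expansion big1 // => k _.
    by apply/eqP; rewrite eq_le rpos // andbT leNgt; apply/negP/rnp.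
  move: r1; rewrite bform_weyl_expansion (bigD1 j) //= => r1.
  set S := \sum_(k < 10 | k != j) _ in r1.
  have S_ge0 : 0 <= S by apply: sumr_ge0 => k _; exact: rpos.
  have [rj1 /eqP] : B r (fund_weight j) = 1 /\ S = 0.
    by move: r1 rj S_ge0; move: (B r _) S => a b; lia.
  rewrite psumr_eq0 => [/allP rk|k _]; last exact: rpos.
  exists j; rewrite [X in X == _]root_expansion (bigD1 j) //= big1 ?addr0.
    by rewrite rj1 scale1r.
  by move=> k kj; have := rk k (mem_index_enum _); rewrite kj => /eqP ->; rewrite scale0r.
pose s i := xchoose (img i); have sE (i : 'I_10) : isom_act g (simple_root i) = simple_root (s i).
  exact/eqP/(xchooseP (img i)).
have s_inj : injective s.
  move=> i j sij; have : isom_act g (simple_root i) = isom_act g (simple_root j) by rewrite !sE sij.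
  move=> /isom_act_inj/(congr1 (fun x => B x (fund_weight i))).
  rewrite !(bform_root_weight (ltn_ord _) (ltn_ord _)) eqxx.
  by case: eqP => [/ord_inj-> //|].
have s_id i : s i = i.
  apply/ord_inj/weyl_coef_inj => //; rewrite -!weyl_weight // -/rho.
  have rhoE : rho = \sum_(j < 10) B rho (fund_weight j) *: simple_root (s j).
    rewrite -[LHS](isom_actVK g) grho [X in isom_act g X]root_expansion isom_act_sum.
    by apply: eq_bigr => j _; rewrite isom_actZ sE.
  rewrite [X in bform _ X _ = _]rhoE bform_suml (bigD1 i isT) /= big1 => [|j ji].
    by rewrite bformZl (bform_root_weight (ltn_ord _) (ltn_ord _)) eqxx mulr1 addr0.
  rewrite bformZl (bform_root_weight (ltn_ord _) (ltn_ord _)).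
  by case: eqP => [/ord_inj/s_inj ij|_]; [rewrite ij eqxx in ji | rewrite mulr0].
apply: isom_act_ext => x; rewrite isom_act1 [in LHS](root_expansion x) isom_act_sum.
by rewrite [RHS]root_expansion; apply: eq_bigr => i _; rewrite isom_actZ sE s_id.
Qed.

Lemma parabolic_walls h (g : isometry latM) : parabolic (walls h) g -> isom_act g h = h.
Proof.
case=> s + -> => {g}; elim: s => [|i s IHs] /=; rewrite ?big_nil ?isom_act1 // big_cons.
move=> /andP[/eqP hi /IHs sh]; rewrite isom_actM sh simple_reflection_int.
by rewrite bformC hi scale0r addr0.
Qed.

Lemma parabolicM J (g h : isometry latM) : parabolic J g -> parabolic J h -> parabolic J (g * h)%g.
Proof. by move=> [s sJ ->] [t tJ ->]; exists (s ++ t); rewrite ?all_cat ?sJ // big_cat. Qed.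

(** Composing [g] with the reflection in a wall of [h] whose root has negative product
    with [g rho] decreases the product of [g rho] and [rho], which stays positive. When
    this is no longer possible, [g^-1] maps every simple root to a positive root: for
    the walls of [h] by construction, and for the other simple roots because their
    product with [h] is positive. Then [g = 1]. *)
Lemma stabilizer_dominant h (g : isometry latM) :
  dominant h -> isom_stab h g -> parabolic (walls h) g.
Proof.
move=> hdom; have [hh hd] := hdom; have h0 := dominant_crd0 hdom.
pose rho : 'cV[int]_(2 + 8) := weyl_vector.
have [m] := ubnP `|B (isom_act g rho) rho|%N; elim: m g => // m IHm g gm gh.
rewrite /isom_stab /= in gh.
have grho0 : 0 < entry (isom_act g rho) 0%N.
  apply: (cone_of_form hh); rewrite ?latM_form_act ?weyl_norm_gt0 //.
  by rewrite -gh latM_form_act bformC cone_bform_gt0 ?weyl_crd0 ?ltW ?weyl_norm_gt0.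
have grho : 0 < B (isom_act g rho) rho.
  by rewrite cone_bform_gt0 ?weyl_crd0 ?latM_form_act ?weyl_norm_gt0 // ltW ?weyl_norm_gt0.
have [[j [jw jneg]]|nneg] := pselect (exists j : 'I_10, walls h j /\
    B (isom_act g rho) (simple_root j) < 0).
  have sE : isom_act (simple_reflection j * g)%g rho =
      isom_act g rho + B (isom_act g rho) (simple_root j) *: simple_root j.
    by rewrite isom_actM simple_reflection_int bformC.
  have /IHm : (`|B (isom_act (simple_reflection j * g)%g rho) rho| < m)%N.
    have : 0 < B (isom_act (simple_reflection j * g)%g rho) rho.
      rewrite cone_bform_gt0 ?weyl_crd0 ?latM_form_act ?weyl_norm_gt0 ?ltW ?weyl_norm_gt0 //.
      apply: (cone_of_form hh); rewrite ?latM_form_act ?weyl_norm_gt0 //.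
      rewrite sE bformDl bformZl (bformC _ (simple_root j) h) (eqP jw) mulr0 addr0.
      by rewrite cone_bform_gt0 ?latM_form_act ?weyl_norm_gt0 ?ltW.
    by rewrite sE bformDl bformZl (bformC _ (simple_root j)) weyl_root //; lia.
  case=> [|s sw sg].
    by rewrite /isom_stab /= isom_actM gh simple_reflection_int bformC (eqP jw) scale0r addr0.
  rewrite -[g](mulKg (simple_reflection j)) simple_reflectionV -/(_ * _)%g sg.
  exists (j :: s); rewrite ?big_cons //= jw; exact: sw.
exists [::]; rewrite // big_nil; apply: invg_inj; rewrite invg1.
apply: positive_isom_trivial => i i10; set r := isom_act _ _.
have rr : B r r = -2 by exact: root_act_norm.
case: (root_sign rr) => [/(root_height_gt0 rr)//|rneg].
have rh_neg : B rho r < 0.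
  rewrite -oppr_gt0 -bformNr root_height_gt0 //.
    by rewrite bformNl bformNr opprK.
  by move=> k k10; rewrite bformNl oppr_ge0 rneg.
exfalso; have [iw|inw] := boolP (walls h i).
  apply: nneg; exists (Ordinal i10); split=> //=.
  by rewrite bform_act_inv.
have : 0 < B h r.
  by rewrite /r -bform_act_inv gh lt0r hd // andbT.
rewrite bform_expansion ltNge sumr_le0 // => k _.
by rewrite mulr_ge0_le0 ?hd ?rneg.
Qed.

Lemma stabilizerE h (g : isometry latM) : dominant h ->
  isom_stab h g <-> parabolic (walls h) g.
Proof.
by move=> hdom; split; [exact: stabilizer_dominant|exact: parabolic_walls].
Qed.

(** The reflection in a simple root having negative product with [h] decreases the
    product of [h] with the Weyl vector, which stays positive in the cone. *)
Lemma dominant_conj h : 0 < B h h -> 0 < entry h 0%N ->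
  exists w : isometry latM, dominant (isom_act w h).
Proof.
have [m] := ubnP `|B h weyl_vector|%N; elim: m h => // m IHm h hm hh h0.
have hrho : 0 < B h weyl_vector by rewrite cone_bform_gt0 ?weyl_crd0 ?ltW ?weyl_norm_gt0.
have [[j jneg]|nneg] := pselect (exists j : 'I_10, B h (simple_root j) < 0); last first.
  exists 1%g; rewrite isom_act1; split=> // i i10; rewrite leNgt; apply/negP => ineg.
  by apply: nneg; exists (Ordinal i10).
have s_rho : B (isom_act (simple_reflection j) h) weyl_vector =
    B h weyl_vector + B h (simple_root j).
  by rewrite simple_reflection_int bformDl bformZl (bformC _ (simple_root j) weyl_vector)
    weyl_root // mulr1 (bformC _ h (simple_root j)).
have s_h : 0 < B (isom_act (simple_reflection j) h) (isom_act (simple_reflection j) h).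
  by rewrite latM_form_act.
have s_h0 : 0 < entry (isom_act (simple_reflection j) h) 0%N.
  apply: (cone_of_form hh) => //; rewrite simple_reflection_int bformDl bformZl.
  rewrite (bformC _ h) ltr_pwDl // -expr2 sqr_ge0 //.
have s_rho_gt0 : 0 < B (isom_act (simple_reflection j) h) weyl_vector.
  by rewrite cone_bform_gt0 ?weyl_crd0 ?ltW ?weyl_norm_gt0.
have [|//|//|w wd] := IHm (isom_act (simple_reflection j) h).
  move: hm s_rho_gt0; rewrite s_rho.
  by move: jneg hrho; move: (B h _) (B h _) => a b; lia.
by exists (w * simple_reflection j)%g; rewrite isom_actM.
Qed.

(** * The two components of the period domain *)

Section ProjectiveAction.
Variables (C : numClosedFieldType) (n : nat) (L : lattice n).
Implicit Types (g h : isometry L) (p q : proj_space C n) (v w : nonzero_vec C n).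

Lemma continuous_mx (X T : topologicalType) m k (f : X -> 'M[T]_(m, k)) :
  (forall i j, continuous (fun x => f x i j)) -> continuous f.
Proof.
move=> fc x A [P Px sPA]; apply: filterS sPA _.
by apply: filter_forall => i; apply: filter_forall => j; apply: fc; exact: Px.
Qed.

Lemma isom_act_continuous g : continuous (@isom_act _ L C g).
Proof.
apply: continuous_mx => i j.
have -> : (fun x : 'cV[C]_n => isom_act g x i j) =
    \sum_k (fun x : 'cV[C]_n => map_mx intr (isom_mx g) i k * x k j).
  by apply/funext => x; rewrite fct_sumE /isom_act mxE.
elim/big_rec: _ => [|k f _ fc] x; first exact: cst_continuous.
apply: continuousD (fc x); apply: continuousM; first exact: cst_continuous.
exact: coord_continuous.
Qed.

Lemma proj_act_pi g v : proj_act g (\pi v) = \pi_(proj_space C n) (nonzero_act g v).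
Proof.
have /proj_eqP[c vE] : \pi_(proj_space C n) (repr (\pi_(proj_space C n) v)) = \pi v.
  by rewrite reprK.
by apply/proj_eqP; exists c; rewrite /= vE isom_actZ.
Qed.

Lemma proj_actM g h p : proj_act (g * h)%g p = proj_act g (proj_act h p).
Proof.
elim/quotW: p => v; rewrite (proj_act_pi h) (proj_act_pi g) (proj_act_pi (g * h)%g).
by congr (\pi _); apply: val_inj; rewrite /= isom_actM.
Qed.

Lemma proj_act1 p : proj_act (1%g : isometry L) p = p.
Proof.
elim/quotW: p => v; rewrite proj_act_pi; congr (\pi _).
by apply: val_inj; rewrite /= isom_act1.
Qed.

Lemma proj_act_continuous g : continuous (@proj_act C _ L g).
Proof.
apply/quotient_continuous.
have -> : proj_act g \o \pi_(proj_space C n) = \pi_(proj_space C n) \o nonzero_act g.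
  by apply/funext => v; exact: proj_act_pi.
move=> v; apply: continuous_comp; last exact: pi_continuous.
move: v; apply: continuous_comp_initial => v.
apply: (@continuous_comp _ _ _ set_val (@isom_act _ L C g)).
  exact: initial_continuous.
exact: isom_act_continuous.
Qed.

Lemma bform_act_conj g (w : 'cV[C]_n) :
  bform L (isom_act g w) (conj_vec (isom_act g w)) = bform L w (conj_vec w).
Proof.
rewrite -[RHS](isom_act_form g); congr (bform _ _ _).
rewrite /conj_vec /isom_act map_mxM -map_mx_comp; congr (_ *m _).
by apply/matrixP => i j; rewrite !mxE /= rmorph_int.
Qed.

Lemma period_domain_act g p : period_domain C L p -> period_domain C L (proj_act g p).
Proof.
case=> w -> [ww wc]; exists (nonzero_act g w); first exact: proj_act_pi.
by rewrite /= isom_act_form bform_act_conj.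
Qed.

(** Isometries act by homeomorphisms preserving the period domain. *)
Lemma component_act g p : proj_act g @` connected_component (period_domain C L) p =
  connected_component (period_domain C L) (proj_act g p).
Proof.
have sub h q : proj_act h @` connected_component (period_domain C L) q `<=`
    connected_component (period_domain C L) (proj_act h q).
  have [Aq|nAq] := pselect (period_domain C L q); last first.
    by rewrite connected_component_out // image_set0.
  apply: connected_component_max.
  - by exists q => //; exact: connected_component_refl.
  - move=> _ [r rq <-]; apply: period_domain_act; exact: connected_component_sub rq.
  - apply: connected_continuous_connected; first exact: component_connected.
    by apply: continuous_subspaceT; exact: proj_act_continuous.
apply/seteqP; split; first exact: sub.
move=> q qc; exists (proj_act g^-1%g q); last by rewrite -proj_actM mulgV proj_act1.
rewrite -[p]proj_act1 -(mulVg g) proj_actM; apply: sub; by exists q.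
Qed.

Lemma isom_plus1 (D : set (proj_space C n)) : isom_plus L D (1%g : isometry L).
Proof.
rewrite /isom_plus /=; apply/seteqP; split=> [_ [p Dp <-]|p Dp].
  by rewrite proj_act1.
by exists p; rewrite ?proj_act1.
Qed.

Lemma isom_plusM (D : set (proj_space C n)) g h :
  isom_plus L D g -> isom_plus L D h -> isom_plus L D (g * h)%g.
Proof.
rewrite /isom_plus /= => gD hD; rewrite -[RHS]gD -[in RHS]hD image_comp.
by apply: eq_imagel => p _; rewrite /= proj_actM.
Qed.

Lemma isom_plusV (D : set (proj_space C n)) g : isom_plus L D g -> isom_plus L D g^-1%g.
Proof.
rewrite /isom_plus /= => gD; rewrite -[in LHS]gD image_comp -[RHS]image_id.
by apply: eq_imagel => p _; rewrite /= -proj_actM mulVg proj_act1.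
Qed.

End ProjectiveAction.

Section Lift.

(** N is the sum of U and of M, up to the bracketing of the sum. *)
Definition joinN (K : comNzRingType) (a : 'cV[K]_2) (m : 'cV[K]_(2 + 8)) :
  'cV[K]_(2 + 2 + 8) := col_mx (col_mx a (usubmx m)) (dsubmx m).

Lemma joinN_surj (K : comNzRingType) (w : 'cV[K]_(2 + 2 + 8)) : exists a m, w = joinN a m.
Proof.
exists (usubmx (usubmx w)), (col_mx (dsubmx (usubmx w)) (dsubmx w)).
by rewrite /joinN col_mxKu col_mxKd !vsubmxK.
Qed.

Lemma joinN_lin (K : comNzRingType) (s : K) (a b : 'cV[K]_2) (m p : 'cV[K]_(2 + 8)) :
  joinN a m + s *: joinN b p = joinN (a + s *: b) (m + s *: p).
Proof. by rewrite /joinN !scale_col_mx !add_col_mx !linearD !linearZ. Qed.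

Lemma bform_joinN (K : comNzRingType) (a b : 'cV[K]_2) (m p : 'cV[K]_(2 + 8)) :
  bform latN (joinN a m) (joinN b p) = bform hypU a b + bform latM m p.
Proof. by rewrite bform_latN /joinN !col_mxKu !col_mxKd !vsubmxK. Qed.

Definition lift_mx (f : 'M[int]_(2 + 8)) : 'M[int]_(2 + 2 + 8) :=
  block_mx (block_mx 1%:M 0 0 (ulsubmx f)) (col_mx 0 (ursubmx f))
           (row_mx 0 (dlsubmx f)) (drsubmx f).

Lemma lift_mxE (K : comNzRingType) f (a : 'cV[K]_2) (m : 'cV[K]_(2 + 8)) :
  map_mx intr (lift_mx f) *m joinN a m = joinN a (map_mx intr f *m m).
Proof.
rewrite -[f in RHS]submxK /lift_mx !map_block_mx map_col_mx map_row_mx !map_mx0 map_mx1.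
rewrite /joinN -[m in RHS]vsubmxK !mul_block_col mul_row_col mul_col_mx !mul0mx mul1mx.
by rewrite addr0 !add0r add_col_mx addr0 col_mxKu col_mxKd.
Qed.

Lemma lift_isomP (f : isometry latM) : (lift_mx f \in unitmx) &&
  ((lift_mx f)^T *m gram latN *m lift_mx f == gram latN).
Proof.
have liftNE (g : isometry latM) (a : 'cV[int]_2) m :
    lift_mx g *m joinN a m = joinN a (isom_act g m).
  by rewrite -lift_mxE map_intr_int.
apply/andP; split.
  suff /mulmx1_unit[] : lift_mx f *m lift_mx f^-1%g = 1%:M by [].
  apply/matrixP => i j; have [a [m mE]] := joinN_surj (delta_mx j 0 : 'cV[int]_(2 + 2 + 8)).
  have : lift_mx f *m lift_mx f^-1%g *m delta_mx j 0 = delta_mx j 0 :> 'cV[int]_(2 + 2 + 8).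
    by rewrite mE -mulmxA !liftNE isom_actVK.
  by rewrite -colE => /colP/(_ i); rewrite !mxE eqxx andbT.
apply: isometryP => x y; have [a [m ->]] := joinN_surj x; have [b [p ->]] := joinN_surj y.
by rewrite !liftNE !bform_joinN isom_act_form.
Qed.

(** The extension of an isometry of M to N by the identity of U. *)
Definition liftN (f : isometry latM) : isometry latN := Isometry (lift_isomP f).

Lemma liftNE (K : comNzRingType) f (a : 'cV[K]_2) (m : 'cV[K]_(2 + 8)) :
  isom_act (liftN f) (joinN a m) = joinN a (isom_act f m).
Proof. exact: lift_mxE. Qed.

Lemma opp_isomP : ((- 1%:M : 'M[int]_(2 + 8)) \in unitmx) &&
  ((- 1%:M)^T *m gram latM *m - 1%:M == gram latM).
Proof.
apply/andP; split; last by apply: isometryP => x y; rewrite !mulNmx !mul1mx bformNl bformNr opprK.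
suff /mulmx1_unit[] : (- 1%:M) *m (- 1%:M) = 1%:M :> 'M[int]_(2 + 8) by [].
by rewrite mulmxN mulNmx mul1mx opprK.
Qed.

Definition opp_isom : isometry latM := Isometry opp_isomP.

Lemma opp_isomE (K : comNzRingType) (m : 'cV[K]_(2 + 8)) : isom_act opp_isom m = - m.
Proof. by rewrite /isom_act map_mxN map_mx1 mulNmx mul1mx. Qed.

End Lift.

Section TubeDomain.
Variable R : realType.
Local Notation C := R[i].
Implicit Types m : 'cV[C]_(2 + 8).

(** Points of the period domain have a nonzero first coordinate. Once it is scaled to 1,
    the second one is determined by the M-component [m], which varies in a tube domain. *)
Definition tube_vec m : 'cV[C]_(2 + 2 + 8) :=
  joinN (\col_i (if i == 0 then 1 else - bform latMhalf m m)) m.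

Definition im_vec m : 'cV[R]_(2 + 8) := map_mx (@complex.Im R) m.

Lemma tube_vec_neq0 m : tube_vec m \in [set v : 'cV[C]_(2 + 2 + 8) | v != 0].
Proof.
rewrite inE /=; apply/eqP => /colP/(_ (lshift 8 (lshift 2 0))).
by rewrite /tube_vec /joinN !col_mxEu !mxE /= => /eqP; rewrite oner_eq0.
Qed.

Definition tube_pt m : proj_space C (2 + 2 + 8) :=
  \pi_(proj_space C (2 + 2 + 8))
    (@exist _ (fun w => w \in _) _ (tube_vec_neq0 m) : nonzero_vec C (2 + 2 + 8)).

Local Notation rc := (real_complex R).

Lemma map_bform n (L : lattice n) (K K' : comNzRingType) (f : {rmorphism K -> K'})
  (x y : 'cV[K]_n) : bform L (map_mx f x) (map_mx f y) = f (bform L x y).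
Proof.
rewrite /bform map_trmx.
have -> : map_mx intr (gram L) = map_mx f (map_mx intr (gram L)) :> 'M[K']_n.
  by apply/matrixP => i j; rewrite !mxE rmorph_int.
by rewrite -!map_mxM mxE.
Qed.

Definition re_vec m : 'cV[R]_(2 + 8) := map_mx (@complex.Re R) m.

Lemma vec_complexE m : m = map_mx rc (re_vec m) + 'i%C *: map_mx rc (im_vec m).
Proof. by apply/colP => k; rewrite !mxE -complexE. Qed.

Lemma conj_vecE m :
  conj_vec m = map_mx rc (re_vec m) - 'i%C *: map_mx rc (im_vec m).
Proof.
by apply/colP => k; rewrite !mxE; case: (m k 0) => a b; simpc.
Qed.

Lemma bform_square m : bform latMhalf m m =
  rc (bform latMhalf (re_vec m) (re_vec m) - bform latMhalf (im_vec m) (im_vec m))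
  + 'i%C * rc (2 * bform latMhalf (re_vec m) (im_vec m)).
Proof.
rewrite [in LHS](vec_complexE m) !(bformDl, bformDr, bformZl, bformZr).
rewrite (bformC _ (map_mx rc (im_vec m))) !map_bform.
rewrite rmorphB rmorphM rmorph_nat.
have := sqr_i R; set j := 'i%C; rewrite expr2 => jj.
rewrite [j * (j * _)]mulrA jj; ring.
Qed.

Lemma bform_hermitian m : bform latMhalf m (conj_vec m) =
  rc (bform latMhalf (re_vec m) (re_vec m) + bform latMhalf (im_vec m) (im_vec m)).
Proof.
rewrite conj_vecE [X in bform _ X _](vec_complexE m).
rewrite !(bformDl, bformDr, bformZl, bformZr, bformNr).
rewrite (bformC _ (map_mx rc (im_vec m)) (map_mx rc (re_vec m))) !map_bform.
rewrite rmorphD.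
have := sqr_i R; set j := 'i%C; rewrite expr2 => jj.
rewrite mulrN [j * (j * _)]mulrA jj; ring.
Qed.

Lemma tube_vec_form m : bform latN (tube_vec m) (tube_vec m) = 0.
Proof.
rewrite bform_joinN bform_hypU bform_latM.
rewrite -!(entryE _ (0 : 'I_2)) -!(entryE _ (1 : 'I_2)) !mxE /=; ring.
Qed.

(** This is minus the norm of [m - conj m], which is twice the imaginary part of [m]
    times a square root of -1. *)
Lemma tube_vec_hermitian m : bform latN (tube_vec m) (conj_vec (tube_vec m)) =
  rc (4 * bform latMhalf (im_vec m) (im_vec m)).
Proof.
have -> : conj_vec (tube_vec m) =
    joinN (\col_i (if i == 0 then 1 else - (bform latMhalf m m)^*%C)) (conj_vec m).
  rewrite /tube_vec /joinN /conj_vec !map_col_mx map_usubmx map_dsubmx.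
  congr (col_mx (col_mx _ _) _); apply/colP => k; rewrite !mxE.
  by case: ifP => _; rewrite ?rmorph1 ?rmorphN.
rewrite bform_joinN bform_hypU bform_latM.
rewrite -!(entryE _ (0 : 'I_2)) -!(entryE _ (1 : 'I_2)) !mxE /= bform_hermitian bform_square.
set a := _ - _; set b := 2 * _.
have -> : (rc a + 'i%C * rc b)^*%C = rc a - 'i%C * rc b by simpc.
rewrite /a /b !(rmorphD, rmorphN, rmorphM, rmorph_nat); ring.
Qed.

Definition tube : set 'cV[C]_(2 + 8) := [set m | 0 < bform latMhalf (im_vec m) (im_vec m)].

Lemma tube_period m : tube m -> period_domain C latN (tube_pt m).
Proof.
move=> mt; eexists; first by [].
by rewrite /= tube_vec_form tube_vec_hermitian ltcR mulr_gt0.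
Qed.

Lemma complex_eq0 (a b : R) : rc a + 'i%C * rc b = 0 -> a = 0 /\ b = 0.
Proof. by simpc => -[-> ->]. Qed.

(** If the first coordinate vanished, the real and imaginary parts of the M-component
    would be orthogonal vectors of the same positive norm, against the Hodge index
    theorem. *)
Lemma period_tube p : period_domain C latN p -> exists2 m, tube m & p = tube_pt m.
Proof.
case=> w -> [ww wc]; have [a [m wE]] := joinN_surj (val w).
have wpos := wc; move: ww wc; rewrite wE.
have -> : conj_vec (joinN a m) = joinN (conj_vec a) (conj_vec m).
  by rewrite /joinN /conj_vec !map_col_mx map_usubmx map_dsubmx.
rewrite !bform_joinN !bform_hypU !bform_latM => ww wc.
have a0 : a 0 0 != 0.
  apply/eqP => a0; move: ww wc.
  rewrite -!(entryE _ (0 : 'I_2)) -!(entryE _ (1 : 'I_2)) !mxE a0.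
  rewrite !rmorph0 !mul0r !mulr0 !add0r => /eqP.
  rewrite mulf_eq0 pnatr_eq0 /= bform_square => /eqP mm.
  rewrite bform_hermitian -(rmorph_nat rc 2) -rmorphM ltcR.
  move: mm => /complex_eq0[xy0 xy].
  rewrite pmulr_rgt0 // => xx.
  have x_gt0 : 0 < bform latMhalf (re_vec m) (re_vec m) by lra.
  have y_gt0 : 0 < bform latMhalf (im_vec m) (im_vec m) by lra.
  have /eqP := xy; rewrite mulf_eq0 pnatr_eq0 /= => /eqP {}xy.
  have y0 : im_vec m != 0 by apply: contraTneq y_gt0 => ->; rewrite bform0l ltxx.
  by have := hodge_index x_gt0 xy y0; rewrite ltNge ltW.
have wE1 : val w = a 0 0 *: tube_vec ((a 0 0)^-1 *: m).
  rewrite wE /tube_vec /joinN !scale_col_mx.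
  rewrite [usubmx (_ *: _)]linearZ [dsubmx (_ *: _)]linearZ /= !scalerA divff // !scale1r.
  congr (col_mx (col_mx _ _) _); apply/colP => k; rewrite !mxE bformZl bformZr.
  have [->|k1] : k = 0 \/ k = 1 by case: k => -[|[|//]] k2; [left|right]; apply: val_inj.
    by rewrite mulr1.
  rewrite k1 /=; move: ww; rewrite -!(entryE _ (0 : 'I_2)) -!(entryE _ (1 : 'I_2)) => ww.
  apply: (mulfI a0); apply: (mulfI (_ : 2 != 0 :> C)); first by rewrite pnatr_eq0.
  apply/eqP; rewrite -subr_eq0; apply/eqP; rewrite -[RHS]ww.
  by field.
exists ((a 0 0)^-1 *: m); last by apply/proj_eqP; exists (a 0 0).
move: wpos; rewrite wE1; set t := tube_vec _; set c := a 0 0 in a0 *.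
have -> : conj_vec (c *: t) = Num.conj c *: conj_vec t by rewrite /conj_vec map_mxZ.
rewrite bformZl bformZr mulrA -normCK pmulr_rgt0 ?exprn_gt0 ?normr_gt0 //.
by rewrite tube_vec_hermitian ltcR pmulr_rgt0.
Qed.

Lemma real_complex_continuous : continuous (rc : R -> (C : numClosedFieldType)).
Proof.
move=> x; apply/(@cvgrPdist_lt (C : numClosedFieldType) (C : numClosedFieldType)) => -[e1 e2].
rewrite ltcE /= => /andP[/eqP-> e0].
have : \forall t \near x, `|x - t| < e1.
  apply/nbhs_ballP; exists e1 => //= t; by rewrite -ball_normE.
apply: filterS => t xt.
rewrite (_ : _ - _ = rc (x - t)); last by rewrite rmorphB.
by rewrite normc_def /= expr0n addr0 sqrtr_sqr ltcR.
Qed.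

(** The paths used below are quadratic in their parameter because the second coordinate
    of [tube_vec] is. *)
Lemma quadratic_path_continuous n (v0 v1 v2 : 'cV[C]_n) :
  continuous ((fun t => v0 + rc t *: v1 + (rc t * rc t) *: v2) :
    R -> 'cV[(C : numClosedFieldType)]_n).
Proof.
apply: continuous_mx => i j x.
have -> : (fun t => (v0 + rc t *: v1 + (rc t * rc t) *: v2) i j) =
    (fun t => v0 i j + rc t * v1 i j + rc t * rc t * v2 i j).
  by apply/funext => t; rewrite !mxE.
have cc := real_complex_continuous.
have ccst (c : C) : continuous ((fun=> c) : R -> (C : numClosedFieldType)).
  by move=> t; exact: cst_continuous.
pose CC := (C : numClosedFieldType).
apply: (@continuousD CC CC).
  apply: (@continuousD CC CC); first exact: ccst.
  by apply: (@continuousM CC); [exact: cc|exact: ccst].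
apply: (@continuousM CC); last exact: ccst.
by apply: (@continuousM CC); exact: cc.
Qed.

Lemma tube_vec_path m d (s : C) : tube_vec (m + s *: d) = tube_vec m
  + s *: joinN (\col_i (if i == 0 then 0 else - (2 * bform latMhalf m d))) d
  + (s * s) *: joinN (\col_i (if i == 0 then 0 else - bform latMhalf d d)) 0.
Proof.
rewrite !joinN_lin scaler0 addr0; congr (joinN _ _); apply/colP => k; rewrite !mxE.
case: ifP => _; first by rewrite !mulr0 !addr0.
by rewrite !(bformDl, bformDr, bformZl, bformZr) (bformC _ d m); ring.
Qed.

Lemma im_vec_path m p (t : R) :
  im_vec (m + rc t *: (p - m)) = im_vec m + t *: (im_vec p - im_vec m).
Proof.
apply/colP => k; rewrite !mxE; case: (m k 0) (p k 0) => a b [c d] /=.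
by rewrite mul0r addr0.
Qed.

(** The two cones of vectors of positive norm are convex. *)
Lemma tube_path m p (t : R) : tube m -> tube p -> 0 < bform latMhalf (im_vec m) (im_vec p) ->
  0 <= t <= 1 -> tube (m + rc t *: (p - m)).
Proof.
rewrite /tube /= im_vec_path; set x := im_vec m; set y := im_vec p => xx yy xy /andP[t0 t1].
rewrite !(bformDl, bformDr, bformZl, bformZr, bformNl, bformNr) (bformC _ y x).
rewrite [ltRHS](_ : _ = (1 - t) ^+ 2 * bform latMhalf x x
  + 2 * t * (1 - t) * bform latMhalf x y + t ^+ 2 * bform latMhalf y y); last by ring.
have [->|t_neq1] := eqVneq t 1; first by rewrite subrr; lra.
have t_lt1 : 0 < 1 - t by rewrite subr_gt0 lt_neqAle t_neq1.
rewrite -addrA ltr_pwDl ?mulr_gt0 ?exprn_gt0 // addr_ge0 ?mulr_ge0 ?sqr_ge0 //.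
all: exact: ltW.
Qed.

Lemma tube_connected m p : tube m -> tube p -> 0 < bform latMhalf (im_vec m) (im_vec p) ->
  connected_component (period_domain C latN) (tube_pt m) (tube_pt p).
Proof.
move=> mt pt mp; pose path (t : R) := m + rc t *: (p - m).
(* The path is defined for all real [t], as the first coordinate is always 1, but it
   stays in the period domain only for [t] in the unit interval. *)
pose f (t : R) : nonzero_vec C (2 + 2 + 8) :=
  @exist _ (fun w => w \in _) _ (tube_vec_neq0 (path t)).
have fc : continuous f.
  apply: continuous_comp_initial.
  pose v0 := tube_vec m.
  pose v1 : 'cV[C]_(2 + 2 + 8) :=
    joinN (\col_i (if i == 0 then 0 else - (2 * bform latMhalf m (p - m)))) (p - m).
  pose v2 : 'cV[C]_(2 + 2 + 8) :=
    joinN (\col_i (if i == 0 then 0 else - bform latMhalf (p - m) (p - m))) 0.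
  have -> : set_val \o f = (fun t => v0 + rc t *: v1 + (rc t * rc t) *: v2).
    by apply/funext => t; exact: tube_vec_path.
  exact: quadratic_path_continuous.
have pfc : continuous (\pi_(proj_space C (2 + 2 + 8)) \o f).
  by move=> t; apply: continuous_comp; [exact: fc|exact: pi_continuous].
have sub : (\pi_(proj_space C (2 + 2 + 8)) \o f) @` `[0, 1] `<=`
    connected_component (period_domain C latN) (tube_pt m).
  apply: connected_component_max.
  - by exists 0; rewrite /= ?in_itv /= ?lexx ?ler01 // /f /path scale0r addr0.
  - by move=> _ [t t01 <-]; apply: tube_period; apply: tube_path.
  - apply: connected_continuous_connected; first exact: segment_connected.
    exact: continuous_subspaceT.
apply: sub; exists 1; first by rewrite /= in_itv /= lexx ler01.
by rewrite /= /f /path scale1r addrC subrK.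
Qed.

Lemma tube_ptN m : proj_act (liftN opp_isom) (tube_pt m) = tube_pt (- m).
Proof.
rewrite proj_act_pi; congr (\pi _); apply: val_inj.
by rewrite /= /tube_vec bformNl bformNr opprK liftNE opp_isomE.
Qed.

(** The imaginary parts of two points of the tube domain have a nonzero product by the
    Hodge index theorem; if it is negative, it becomes positive when one of the points
    is replaced by its opposite. *)
Lemma period_component p q : period_domain C latN p -> period_domain C latN q ->
  connected_component (period_domain C latN) p q \/
  connected_component (period_domain C latN) p (proj_act (liftN opp_isom) q).
Proof.
move=> /period_tube[x xt ->] /period_tube[y yt ->]; rewrite tube_ptN.
have Ny : im_vec (- y) = - im_vec y.
  by apply/colP => k; rewrite !mxE; case: (y k 0).
have : bform latMhalf (im_vec x) (im_vec y) != 0.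
  apply/eqP => xy; have y0 : im_vec y != 0.
    by apply: contraTneq yt => y0; rewrite /tube /= y0 bform0l ltxx.
  by have := hodge_index xt xy y0; rewrite ltNge ltW.
rewrite neq_lt => /orP[xy|xy]; [right|left]; apply: tube_connected => //.
  by rewrite /tube /= Ny bformNl bformNr opprK.
by rewrite Ny bformNr oppr_gt0.
Qed.

(** Isometries permute the components, and [period_component] leaves only the component
    [D] and its image under id + (-id). *)
Lemma isom_plus_lift (D : set (proj_space C (2 + 2 + 8))) (g : isometry latN) :
  is_component (period_domain C latN) D ->
  isom_plus latN D g \/ isom_plus latN D (liftN opp_isom * g)%g.
Proof.
move=> [p pA ->]; rewrite /isom_plus /= !component_act proj_actM.
by case: (period_component pA (period_domain_act g pA)) => pq; [left|right];
  rewrite (same_connected_component pq).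
Qed.

End TubeDomain.

(** * Conjugacy classes of subgroups and orbits on the discriminant group *)

Section DiscAction.
Variables (n : nat) (L : lattice n).

Lemma disc_actM (g h : isometry L) d : disc_act (g * h)%g d = disc_act g (disc_act h d).
Proof.
elim/quotW: d => x; rewrite (disc_actE h) (disc_actE g) disc_actE; congr (\pi _).
by apply: val_inj; rewrite /= isom_actM.
Qed.

Lemma disc_act1 d : disc_act (1%g : isometry L) d = d.
Proof.
by elim/quotW: d => x; rewrite disc_actE; congr (\pi _); apply: val_inj; rewrite /= isom_act1.
Qed.

End DiscAction.

Lemma joinN_dual (x : dual_lattice latM) : joinN 0 (dual_val x) \in in_dual latN.
Proof.
have /asboolP xM := dual_valP x; apply/asboolP => w; have [a [m ->]] := joinN_surj w.
rewrite bform_joinN bform0l add0r /joinN !integral_col_mx => /andP[/andP[_ uZ] dZ].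
by apply: xM; rewrite integral_cmx uZ dZ.
Qed.

Definition dual_joinN x : dual_lattice latN := DualVec (joinN_dual x).

(** The sign convention in the embeddings of M and N does not matter, as D(M) is
    2-elementary. *)
Lemma glue_pi x : glue (\pi_(disc_group latM) x) = \pi_(disc_group latN) (dual_joinN x).
Proof.
apply: glued_fun (glueP _) _; exists x, (dual_joinN x); split=> //=.
have [aZ uZ] := dual_latM (dual_valP x).
rewrite /embM /embN /joinN !col_mxKu !col_mxKd !add_col_mx !integral_col_mx !subrr.
by rewrite addr0 !integral_vec0 -!mulr2n aZ uZ.
Qed.

Lemma glue_inj : injective glue.
Proof. exact: bij_inj glue_bij. Qed.

Lemma glue_lift f d : disc_act (liftN f) (glue d) = glue (disc_act f d).
Proof.
elim/quotW: d => x; rewrite disc_actE !glue_pi disc_actE; congr (\pi _).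
by apply: val_inj; rewrite /= liftNE.
Qed.

(** The discriminant group of M is 2-elementary. *)
Lemma disc_act_opp d : disc_act opp_isom d = d.
Proof.
elim/quotW: d => x; rewrite disc_actE; apply/disc_eqP => /=.
rewrite opp_isomE -opprD integral_vecN -mulr2n.
have [aZ uZ] := dual_latM (dual_valP x).
by rewrite integral_cmx !linearMn aZ uZ.
Qed.

Lemma glue_lift_opp e : disc_act (liftN opp_isom) e = e.
Proof. by have [f _ fK] := glue_bij; rewrite -[e]fK glue_lift disc_act_opp. Qed.

Section Conjugacy.
Variables (R : realType) (D : set (proj_space R[i] (2 + 2 + 8))).
Hypothesis D_component : is_component (period_domain R[i] latN) D.
Local Notation K := (isom_plus latN D).
Implicit Types (h : 'cV[int]_(2 + 8)) (f : isometry latM) (g : isometry latN).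

(** If the extension by the identity of U exchanges the components, its composite with
    id + (-id) does not, and both act in the same way on D(N). *)
Lemma plus_lift f : exists2 g, K g & forall d, disc_act g (glue d) = glue (disc_act f d).
Proof.
have [Kf|Kf] := isom_plus_lift (liftN f) D_component.
  by exists (liftN f) => // d; rewrite glue_lift.
by exists (liftN opp_isom * liftN f)%g => // d; rewrite disc_actM glue_lift_opp glue_lift.
Qed.

Definition polarized_group h : set (isometry latN) := Gamma h `&` K.
Definition polarized_class h := conj_class K (polarized_group h).

Lemma conj_class_eq (H H' : set (isometry latN)) g :
  K g -> H' = [set (x ^ g)%g | x in H] -> conj_class K H = conj_class K H'.
Proof.
move=> Kg ->; apply/seteqP; split=> _ [k Kk ->].
  exists (g^-1 * k)%g; first by apply: isom_plusM => //; exact: isom_plusV.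
  rewrite image_comp; apply: eq_imagel => x _ /=.
  by rewrite -conjgM mulVKg.
exists (g * k)%g; first exact: isom_plusM.
by rewrite image_comp; apply: eq_imagel => x _ /=; rewrite conjgM.
Qed.

(** A lift of [s] to O^+(N) conjugates one group into the other, both being full
    preimages in O^+(N) of their images in O(D(N)). *)
Lemma polarized_class_conj h h' s :
  (forall f, isom_stab h f <-> isom_stab h' (s * f * s^-1)%g) ->
  polarized_class h = polarized_class h'.
Proof.
move=> hh'; have [g Kg gs] := plus_lift s.
have gsV d : disc_act g^-1%g (glue d) = glue (disc_act s^-1%g d).
  rewrite -{1}[d]disc_act1 -(mulgV s) disc_actM -gs.
  by rewrite -disc_actM mulVg disc_act1.
apply: (@conj_class_eq _ _ g^-1%g); first exact: isom_plusV.
apply/seteqP; split=> [x [[f fh' fxE] Kx]|_ [x [[f fh fxE] Kx] <-]];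
  have fx d : disc_act x (glue d) = glue (disc_act f d) := fxE d.
  exists (x ^ g)%g; last by rewrite -conjgM mulgV conjg1.
  split; last by rewrite conjgE; do !apply: isom_plusM => //; exact: isom_plusV.
  exists (s^-1 * f * s)%g.
    by apply/hh'; rewrite !mulgA mulgV mul1g mulgK.
  by move=> d; rewrite /= conjgE !disc_actM gs fx gsV.
split; last first.
  by rewrite conjgE invgK; do !apply: isom_plusM => //; exact: isom_plusV.
exists (s * f * s^-1)%g; first exact/hh'.
by move=> d; rewrite /= conjgE invgK !disc_actM gsV fx gs.
Qed.

Definition same_orbit h : disc_group latM -> disc_group latM -> Prop :=
  fun d e => exists2 f, isom_stab h f & disc_act f d = e.

(** Every element of the stabilizer of [h] has a lift in the polarized group, so that an
    isometry conjugating two polarized groups acts on D(N) by a bijection which carries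
    the orbits of one stabilizer to those of the other. *)
Lemma polarized_class_orbits h h' : polarized_class h = polarized_class h' ->
  exists2 s : disc_group latM -> disc_group latM, bijective s &
    forall d e, same_orbit h' d e <-> same_orbit h (s d) (s e).
Proof.
move=> hh'; have : polarized_class h' (polarized_group h').
  exists 1%g; first exact: isom_plus1.
  by apply/seteqP; split=> [x xH|_ [x xH <-]]; [exists x; rewrite ?conjg1|rewrite conjg1].
rewrite -hh' => -[k Kk Gk].
have [ginv glueK ginvK] := glue_bij.
pose s d := ginv (disc_act k (glue d)).
have sE d : glue (s d) = disc_act k (glue d) by rewrite /s ginvK.
exists s.
  exists (fun d => ginv (disc_act k^-1%g (glue d))) => d; rewrite /s ginvK -disc_actM.
    by rewrite mulVg disc_act1 glueK.
  by rewrite mulgV disc_act1 glueK.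
move=> d e; split=> [[f fh' <-]|[f fh fd]].
  have [g Kg gf] := plus_lift f.
  have : polarized_group h' g by split=> //; exists f.
  rewrite Gk => -[x [[f1 f1h xf1] Kx] xg]; exists f1 => //.
  apply: glue_inj; rewrite -[LHS]xf1 !sE -gf -xg /=.
  by rewrite -!disc_actM conjgE !mulgA mulgV mul1g.
have [x Kx xf] := plus_lift f.
have : polarized_group h' (x ^ k)%g by rewrite Gk; exists x => //; split=> //; exists f.
case=> -[f1 f1h' xf1] _; exists f1 => //.
apply: glue_inj; rewrite -[LHS]xf1 /=.
have /(congr1 glue) := fd; rewrite sE -xf sE -!disc_actM => /(congr1 (disc_act k^-1%g)).
by rewrite -!disc_actM mulVg disc_act1 conjgE.
Qed.

End Conjugacy.

(** * Exploring graphs on bit sequences *)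

(** Searching lists of up to 1024 visited vertices would dominate the computation. *)
Inductive trie := Leaf | Node of bool & trie & trie.

Fixpoint tmem (t : trie) (c : bitseq) : bool :=
  match t, c with
  | Leaf, _ => false
  | Node b _ _, [::] => b
  | Node _ l r, x :: c' => if x then tmem r c' else tmem l c'
  end.

Fixpoint tadd (t : trie) (c : bitseq) : trie :=
  let: (b, l, r) := if t is Node b l r then (b, l, r) else (false, Leaf, Leaf) in
  match c with
  | [::] => Node true l r
  | x :: c' => if x then Node b l (tadd r c') else Node b (tadd l c') r
  end.

Lemma tmem_add t c d : tmem (tadd t c) d = (d == c) || tmem t d.
Proof.
elim: c t d => [|x c IHc] [|b l r] [|y d] //=; first by case: y; case: d.
- by case: x.
- by case: x; case: y; rewrite eqseq_cons //= ?IHc // orbF.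
- by case: x.
- by case: x; case: y; rewrite eqseq_cons //= IHc.
Qed.

Section Explore.
Variable nb : bitseq -> seq bitseq.

(** Depth-first search. The fuel bounds the number of vertices taken from [todo]. *)
Fixpoint explore (fuel : nat) (todo : seq bitseq) (seen : trie) (acc : seq bitseq) :=
  match fuel, todo with
  | _, [::] => Some (seen, acc)
  | 0%N, _ => None
  | fuel'.+1, c :: todo' =>
      if tmem seen c then explore fuel' todo' seen acc
      else explore fuel' (nb c ++ todo') (tadd seen c) (c :: acc)
  end.

Fixpoint components (fuel : nat) (univ : seq bitseq) (seen : trie) :
    option (seq (bitseq * seq bitseq)) :=
  if univ is c :: univ' then
    if tmem seen c then components fuel univ' seen
    else if explore fuel [:: c] seen [::] is Some (seen', l)
    then omap (cons (c, l)) (components fuel univ' seen') else None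
  else Some [::].

(** [W] is the set of vertices visited before the search began, and [acc] that of the
    vertices visited since then. [Q] is any property that propagates along edges. *)
Lemma explore_spec (Q : bitseq -> Prop) fuel todo seen acc W seen' l :
  (forall x y, Q x -> y \in nb x -> Q y) ->
  explore fuel todo seen acc = Some (seen', l) ->
  (forall x, tmem seen x = (x \in acc ++ W)) -> uniq (acc ++ W) ->
  (forall x, x \in acc ++ todo -> Q x) ->
  (forall x y, x \in acc -> y \in nb x -> y \in acc ++ W ++ todo) ->
  [/\ forall x, tmem seen' x = (x \in l ++ W), uniq (l ++ W),
      forall x, x \in l -> Q x, {subset acc ++ todo <= l ++ W}
    & forall x y, x \in l -> y \in nb x -> y \in l ++ W].
Proof.
move=> Qnb; elim: fuel todo seen acc => [|fuel IH] [|c todo] seen acc //=.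
- move=> [<- <-] seenE uniqW Qx cl; split=> // [x xa|x|x y xa /(cl _ _ xa)].
  + by apply: Qx; rewrite cats0.
  + by rewrite !mem_cat orbF => ->.
  + by rewrite cats0.
- move=> [<- <-] seenE uniqW Qx cl; split=> // [x xa|x|x y xa /(cl _ _ xa)].
  + by apply: Qx; rewrite cats0.
  + by rewrite !mem_cat orbF => ->.
  + by rewrite cats0.
move=> E seenE uniqW Qx cl; move: E; case: ifPn => cs E.
  have [|x y xa yx|? ? ? sub ?] := IH _ _ _ E seenE uniqW.
  - by move=> x; rewrite mem_cat => xat; apply: Qx; rewrite mem_cat inE orbCA xat orbT.
  - have := cl _ _ xa yx; rewrite !mem_cat inE => /or3P[->//|->|/orP[/eqP->|->]]; rewrite ?orbT //.
    by move: cs; rewrite seenE mem_cat => /orP[]->; rewrite ?orbT.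
  split=> // x; rewrite mem_cat inE => /or3P[xa|/eqP->|xt].
  - by apply: sub; rewrite mem_cat xa.
  - move: cs; rewrite seenE mem_cat => /orP[ca|cW].
      by apply: sub; rewrite mem_cat ca.
    by rewrite mem_cat cW orbT.
  - by apply: sub; rewrite mem_cat xt orbT.
have Qc : Q c by apply: Qx; rewrite mem_cat inE eqxx orbT.
have [|||x y|? ? ? sub ?] := IH _ _ _ E.
- by move=> x; rewrite tmem_add seenE.
- by rewrite /= uniqW andbT -seenE.
- move=> x; rewrite /= inE !mem_cat => /or3P[/eqP->//|xa|/orP[/(Qnb _ _ Qc)//|xt]].
    by apply: Qx; rewrite mem_cat xa.
  by apply: Qx; rewrite mem_cat inE xt !orbT.
- rewrite inE => /orP[/eqP->|xa] yx; first by rewrite !mem_cat yx !orbT.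
  have := cl _ _ xa yx; rewrite !(mem_cat, inE).
  by move=> /or3P[->|->|/orP[->|->]]; rewrite ?orbT.
split=> // x; rewrite mem_cat inE => /or3P[xa|/eqP->|xt]; apply: sub;
  by rewrite !mem_cat inE ?xa ?eqxx ?xt ?orbT.
Qed.

(** [Q c x] stands for a relation between a start vertex [c] and the vertices [x]
    reached from it. If edges are symmetric, each set of the result is closed under
    [nb], as an edge leaving it would lead to an earlier closed set. *)
Lemma components_spec (Q : bitseq -> bitseq -> Prop) fuel univ seen W L :
  (forall c x y, Q c x -> y \in nb x -> Q c y) -> (forall c, c \in univ -> Q c c) ->
  components fuel univ seen = Some L ->
  (forall x, tmem seen x = (x \in W)) -> uniq W ->
  (forall x y, x \in W -> y \in nb x -> y \in W) ->
  [/\ uniq (flatten (unzip2 L) ++ W), {subset univ <= flatten (unzip2 L) ++ W},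
      {subset unzip1 L <= univ}, forall p x, p \in L -> x \in p.2 -> Q p.1 x
    & (forall c x y, Q c x -> y \in nb x -> x \in nb y) ->
      forall p x y, p \in L -> x \in p.2 -> y \in nb x -> y \in p.2].
Proof.
move=> Qnb; elim: univ seen W L => [|c univ IH] seen W L /= Quniv.
  by move=> [<-].
have Qu x : x \in univ -> Q x x by move=> xu; apply: Quniv; rewrite inE xu orbT.
move=> + seenE uniqW clW; case: ifPn => cs.
  move=> /IH -/(_ W Qu seenE uniqW clW)[? sub subL ? ?]; split=> // x.
    by rewrite inE => /orP[/eqP->|/sub//]; rewrite mem_cat -seenE cs orbT.
  by move=> /subL; rewrite inE orbC => ->.
case E: explore => [[seen' l]|//].
have [//|//|x|//|seen'E uniq' Ql sub' cl'] := explore_spec (Qnb c) E (W := W).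
  by rewrite inE => /eqP->; apply: Quniv; rewrite inE eqxx.
case EL: components => [L'|//] [<-] /=.
have [x y|? sub subL QL symL] := IH _ (l ++ W) _ Qu EL seen'E uniq'.
  rewrite mem_cat => /orP[/cl'|xW yx]; first exact.
  by rewrite mem_cat (clW _ _ xW yx) orbT.
have inLW x : x \in flatten (unzip2 L') ++ l ++ W -> x \in (l ++ flatten (unzip2 L')) ++ W.
  by rewrite !mem_cat orbA (orbC (x \in flatten _)).
split.
- by rewrite -catA uniq_catCA.
- move=> x; rewrite inE => /orP[/eqP->|/sub/inLW//].
  by apply: inLW; rewrite mem_cat sub' ?orbT // inE eqxx.
- by move=> x; rewrite !inE => /orP[->//|/subL->]; rewrite orbT.
- by move=> p x; rewrite inE => /orP[/eqP->|/QL]; [exact: Ql|apply].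
- move=> sym p x y; rewrite inE => /orP[/eqP->|pL]; last exact: symL.
  move=> xl yx; have := cl' _ _ xl yx; rewrite mem_cat => /orP[//|yW].
  have xW := clW _ _ yW (sym _ _ _ (Ql _ xl) yx).
  by move: uniq'; rewrite cat_uniq => /and3P[_ /hasPn/(_ x xW)/negP].
Qed.

End Explore.

Fixpoint bitseqs (n : nat) : seq bitseq :=
  if n is n'.+1 then map (cons false) (bitseqs n') ++ map (cons true) (bitseqs n') else [:: [::]].

(** The action modulo 2 of the j-th simple reflection on the coefficients. *)
Definition toggle (j : nat) (c : bitseq) : bitseq :=
  set_nth false c j
    (foldr (fun k b => nth false c k (+) b) (nth false c j) (nth [::] dynkin_nbrs j)).

Definition toggles (J c : bitseq) : seq bitseq :=
  [seq toggle j c | j <- iota 0 10 & nth false J j].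

(** Orbits are the components of the graph of toggles; an orbit with k elements
    contributes k^2 pairs. Binary numbers are used because the totals exceed two hundred
    thousand. *)
Definition computed_orbit_pairs (J : bitseq) : option BinNums.N :=
  omap (foldr (fun x s => let k := BinNat.N.of_nat (size x.2) in
                          BinNat.N.add (BinNat.N.mul k k) s) BinNums.N0)
    (components (toggles J) (2 ^ 14)%N (bitseqs 10) Leaf).

Definition unit_list (j : nat) : seq int := mkseq (fun k => (k == j)%:R) 10.

(** The i-th simple reflection on the coefficients with respect to the simple roots. *)
Definition root_refl (i : nat) (x : seq int) : seq int :=
  set_nth 0 x i (foldr (fun k a => x`_k + a) (- x`_i) (nth [::] dynkin_nbrs i)).

(** The i-th simple reflection on the products with the simple roots. *)
Definition weight_refl (i : nat) (y : seq int) : seq int :=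
  mkseq (fun k => if k == i then - y`_i
                  else if k \in nth [::] dynkin_nbrs i then y`_k + y`_i else y`_k) 10.

(** A word of reflections in the simple roots of [u] making the weight [y] antidominant
    for [u]. Started at the fundamental weight of a node [s] of [u], of finite type, it
    spells w_0(u) w_0(u - s), with w_0 the longest element of a parabolic subgroup. *)
Fixpoint lowering_word (fuel : nat) (u : bitseq) (y : seq int) : seq nat :=
  if fuel is fuel'.+1 then
    let i := find (fun k => nth false u k && (0 < y`_k)) (iota 0 10) in
    if (i < 10)%N then i :: lowering_word fuel' u (weight_refl i y) else [::]
  else [::].

(** The image of the set [J] under the element w_0(J + s) w_0(J) of the Weyl group. The
    element is only searched for, with fuel, as J + s may be of infinite type; that it
    maps simple roots to simple roots is checked afterwards. *)
Definition adjacent_face (J : bitseq) (s : nat) : option bitseq :=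
  let w := lowering_word 128 (set_nth false J s true) (unit_list s) in
  let imgs := [seq foldl (fun x i => root_refl i x) (unit_list j) w
              | j <- iota 0 10 & nth false J j] in
  if all (fun x => x \in [seq unit_list i | i <- iota 0 10]) imgs
  then Some (mkseq (fun i => unit_list i \in imgs) 10) else None.

(** The face with walls [J] is spanned by the fundamental weights outside [J], all of
    which have positive norm but [fund_weight 9]. *)
Definition positive_face (J : bitseq) : bool := ~~ all id (take 9 J).

Definition adjacent_faces (J : bitseq) : seq bitseq :=
  [seq J' <- pmap (adjacent_face J) [seq s <- iota 0 10 | ~~ nth false J s] | positive_face J'].

Lemma mem_bitseqs n c : (c \in bitseqs n) = (size c == n).
Proof.
elim: n c => [|n IHn] [|x c] //=; rewrite mem_cat.
  by apply/negbTE/norP; split; apply/mapP => -[].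
rewrite eqSS -IHn; apply/orP/idP => [[]/mapP[d dn [_ ->]]//|cn].
by case: x; [right|left]; apply/mapP; exists c.
Qed.

Lemma uniq_bitseqs n : uniq (bitseqs n).
Proof.
elim: n => //= n IHn; rewrite cat_uniq !map_inj_uniq ?IHn => [|c d []|c d []] //=.
by rewrite andbT; apply/hasPn => _ /mapP[c _ ->]; apply/mapP => -[].
Qed.

(** * Coordinates on the lattice and on the discriminant group *)

Lemma dynkin_nbrs_lt j : all (gtn 10) (nth [::] dynkin_nbrs j).
Proof. by do 10![case: j => [//|j]]; rewrite [nth _ _ _]nth_default. Qed.

(** The products with the i-th simple root in terms of its neighbours only, as
    [root_refl] and [toggle] compute them; the coefficient -2 is split in two. *)
Lemma root_gram_sum (F : nat -> int) i : (i < 10)%N ->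
  \sum_(k < 10) root_gram i k * F k =
  foldr (fun k a => F k + a) (- F i) (nth [::] dynkin_nbrs i) - F i.
Proof.
move=> i10; rewrite !big_ord_recl big_ord0 /root_gram /=; move: i i10.
do 10![case=> [_|] /=; first by ring].
by [].
Qed.

Lemma root_form_expansion (i : nat) y : (i < 10)%N ->
  B (simple_root i) y = foldr (fun k a => B y (fund_weight k) + a)
    (- B y (fund_weight i)) (nth [::] dynkin_nbrs i) - B y (fund_weight i).
Proof.
move=> i10; rewrite -(root_gram_sum (fun k => B y (fund_weight k))) //.
rewrite [y in LHS]root_expansion bform_sumr; apply: eq_bigr => k _.
by rewrite bformZr bform_roots // mulrC.
Qed.

Lemma reflection_weight (j : 'I_10) i y : (i < 10)%N ->
  B (isom_act (simple_reflection j) y) (fund_weight i) =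
  B y (fund_weight i) + (if i == j then B (simple_root j) y else 0).
Proof.
move=> i10; rewrite simple_reflection_int bformDl bformZl bform_root_weight // eq_sym.
by case: eqP; rewrite ?mulr1 ?mulr0.
Qed.

Definition root_comb (x : seq int) := \sum_(i < 10) x`_i *: simple_root i.

Lemma root_comb_coef x i : (i < 10)%N -> B (root_comb x) (fund_weight i) = x`_i.
Proof.
move=> i10; rewrite bform_suml (bigD1 (Ordinal i10) isT) /= big1 => [|j ji].
  by rewrite bformZl bform_root_weight // eqxx mulr1 addr0.
rewrite bformZl bform_root_weight //; case: eqP => [ij|]; last by rewrite mulr0.
by rewrite -val_eqE /= ij eqxx in ji.
Qed.

Lemma root_comb_refl (j : 'I_10) x :
  isom_act (simple_reflection j) (root_comb x) = root_comb (root_refl j x).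
Proof.
apply: coef_inj => i i10; rewrite reflection_weight // !root_comb_coef //.
rewrite /root_refl nth_set_nth /= root_form_expansion //.
case: eqP => [->|_]; last by rewrite addr0.
rewrite addrC root_comb_coef // subrK.
have := dynkin_nbrs_lt j.
by elim: (nth [::] dynkin_nbrs j) => //= k s IHs /andP[k10 /IHs ->]; rewrite root_comb_coef.
Qed.

Lemma root_comb_unit i : (i < 10)%N -> root_comb (unit_list i) = simple_root i.
Proof.
move=> i10; apply: coef_inj => j j10; rewrite root_comb_coef // bform_root_weight //.
by rewrite nth_mkseq // eq_sym.
Qed.

Definition odd_int (z : int) : bool := odd `|z|%N.

Lemma odd_intD a b : odd_int (a + b) = odd_int a (+) odd_int b.
Proof. by rewrite /odd_int; lia. Qed.

Lemma odd_intN a : odd_int (- a) = odd_int a.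
Proof. by rewrite /odd_int abszN. Qed.

(** The class of a vector modulo 2, read off its coefficients on the simple roots. *)
Definition code (y : 'cV[int]_(2 + 8)) : bitseq :=
  mkseq (fun i => odd_int (B y (fund_weight i))) 10.

Lemma size_code y : size (code y) = 10%N.
Proof. exact: size_mkseq. Qed.

Lemma nth_code y i : (i < 10)%N -> nth false (code y) i = odd_int (B y (fund_weight i)).
Proof. exact: nth_mkseq. Qed.

(** The coefficient -2 of the reflected root disappears modulo 2. *)
Lemma code_reflection (j : 'I_10) y :
  code (isom_act (simple_reflection j) y) = toggle j (code y).
Proof.
have sz : size (toggle j (code y)) = 10%N.
  by rewrite size_set_nth size_code; apply/maxn_idPr.
apply: (@eq_from_nth _ false) => [|i]; rewrite size_code ?sz // => i10.
rewrite nth_set_nth /= !nth_code // reflection_weight //.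
case: eqP => [->|_]; last by rewrite addr0.
rewrite root_form_expansion // addrC -addrA addNr addr0.
have := dynkin_nbrs_lt j.
elim: (nth [::] dynkin_nbrs j) => [_|k s IHs /= /andP[k10 /IHs <-]].
  by rewrite -[RHS]odd_intN.
by rewrite odd_intD nth_code.
Qed.

Lemma half_dual (y : 'cV[int]_(2 + 8)) : 2^-1 *: map_mx intr y \in in_dual latM.
Proof.
apply/asboolP => z /integral_vecP[t ->]; rewrite bform_latM bformZl mulrA mulfV // mul1r.
by rewrite map_bform intr_int.
Qed.

(** D(M) is (1/2)M(1/2) modulo M(1/2), so that [y / 2] runs through all classes and only
    depends on [y] modulo 2. *)
Definition half_class y : disc_group latM := \pi_(disc_group latM) (DualVec (half_dual y)).

Lemma half_class_eq y z : half_class y = half_class z <-> code y = code z.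
Proof.
split=> [/disc_eqP/integral_vecP[t yzt]|yz].
  have -> : y = z + 2 *: t.
    apply/matrixP => i j; move/matrixP/(_ i j): yzt; rewrite !mxE => yzt.
    apply: (@intr_inj rat); rewrite rmorphD rmorphM /= -yzt.
    by field.
  apply/eq_mkseq => i; rewrite bformDl bformZl odd_intD.
  by rewrite [odd_int (2 * _)](_ : _ = false) ?addbF // /odd_int abszM oddM.
apply/disc_eqP/integral_vecP.
pose t := \sum_(i < 10) ((B (y - z) (fund_weight i)) %/ 2)%Z *: simple_root i.
exists t.
have yzt : y - z = 2 *: t.
  rewrite [LHS]root_expansion scaler_sumr; apply: eq_bigr => i _; rewrite scalerA.
  congr (_ *: _); rewrite mulrC divzK // dvdzE /= dvdn2.
  have /(congr1 (nth false ^~ i)) := yz; rewrite !nth_code // => yzi.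
  have := odd_intD (B y (fund_weight i)) (- B z (fund_weight i)).
  by rewrite odd_intN yzi addbb bformDl bformNl /odd_int => ->.
rewrite /= -scalerBr -map_mxB yzt map_mxZ scalerA.
by rewrite mulVf // scale1r.
Qed.

Lemma half_class_surj d : exists y, d = half_class y.
Proof.
elim/quotW: d => x; have [aZ uZ] := dual_latM (dual_valP x).
have /integral_vecP[y xy] : integral_vec (dual_val x *+ 2).
  by rewrite integral_cmx !linearMn aZ uZ.
exists y; congr (\pi _); apply: val_inj => /=.
by rewrite -xy -scaler_nat scalerA mulVf // scale1r.
Qed.

Lemma half_class_act (f : isometry latM) y :
  disc_act f (half_class y) = half_class (isom_act f y).
Proof.
rewrite disc_actE; congr (\pi _); apply: val_inj => /=.
by rewrite isom_actZ /isom_act map_intr_int map_mxM.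
Qed.

(** * Pairs in a common orbit *)

Definition bit_vec (c : bitseq) := root_comb [seq (nat_of_bool b)%:Z | b <- c].

Lemma code_bit_vec c : size c = 10%N -> code (bit_vec c) = c.
Proof.
move=> c10; apply: (@eq_from_nth _ false) => [|i]; rewrite size_code ?c10 // => i10.
rewrite nth_code // root_comb_coef // (nth_map false) ?c10 //.
by case: (nth false c i).
Qed.

(** Together with [bit_class_inj] and [bit_class_surj], this identifies D(M) with the
    bit sequences of length 10. *)
Definition bit_class c := half_class (bit_vec c).

Lemma bit_class_code y : bit_class (code y) = half_class y.
Proof. by apply/half_class_eq; rewrite code_bit_vec // size_code. Qed.

Lemma bit_class_inj c c' : size c = 10%N -> size c' = 10%N ->
  bit_class c = bit_class c' -> c = c'.
Proof. by move=> s s' /half_class_eq; rewrite !code_bit_vec. Qed.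

Lemma bit_class_surj d : exists2 c, size c = 10%N & bit_class c = d.
Proof.
have [y ->] := half_class_surj d; exists (code y); first exact: size_code.
exact: bit_class_code.
Qed.

Definition reach (J c c' : bitseq) : Prop :=
  exists2 s : seq 'I_10, all (fun i : 'I_10 => nth false J i) s &
    c' = foldr (fun j : 'I_10 => toggle j) c s.

Lemma code_word (s : seq 'I_10) y :
  code (isom_act (\prod_(i <- s) simple_reflection i)%g y) =
  foldr (fun j : 'I_10 => toggle j) (code y) s.
Proof.
elim: s => [|j s IHs] /=; first by rewrite big_nil isom_act1.
by rewrite big_cons isom_actM code_reflection IHs.
Qed.

Definition has_walls (h : 'cV[int]_(2 + 8)) (J : bitseq) :=
  dominant h /\ forall i, (i < 10)%N -> walls h i = nth false J i.

Lemma has_walls_all h J (s : seq 'I_10) : has_walls h J ->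
  all (fun i : 'I_10 => walls h i) s = all (fun i : 'I_10 => nth false J i) s.
Proof. by move=> [_ hJ]; apply: eq_all => i; exact: hJ. Qed.

(** The stabilizer is generated by the simple reflections in [J], which act as toggles. *)
Lemma same_orbit_reach h J c c' : has_walls h J -> size c = 10%N -> size c' = 10%N ->
  same_orbit h (bit_class c) (bit_class c') <-> reach J c c'.
Proof.
move=> hJ c10 c'10; have [hd _] := hJ; split=> [[f /(stabilizerE _ hd)[s]]|[s sJ ->]].
  rewrite (has_walls_all _ hJ) => sJ ->; rewrite half_class_act => /half_class_eq.
  by rewrite code_word !code_bit_vec // => <-; exists s.
exists (\prod_(i <- s) simple_reflection i)%g.
  by apply/(stabilizerE _ hd); exists s => //; rewrite (has_walls_all _ hJ).
rewrite half_class_act -bit_class_code code_word code_bit_vec //.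
Qed.

(** The invariant that separates the classes. *)
Definition orbit_pairs h : nat :=
  \sum_(c <- bitseqs 10)
    count (fun c' => `[< same_orbit h (bit_class c) (bit_class c') >]) (bitseqs 10).

Lemma size_toggle j c : (j < 10)%N -> size c = 10%N -> size (toggle j c) = 10%N.
Proof. by move=> j10 c10; rewrite size_set_nth c10; apply/maxn_idPr. Qed.

(** Toggles are induced by reflections. *)
Lemma toggleK j c : (j < 10)%N -> size c = 10%N -> toggle j (toggle j c) = c.
Proof.
move=> j10 c10; rewrite -[c]code_bit_vec //.
rewrite -!(code_reflection (Ordinal j10)) -isom_actM -{1}(simple_reflectionV (Ordinal j10)).
by rewrite mulVg isom_act1.
Qed.

Lemma togglesP J c c' : reflect (exists2 j : 'I_10, nth false J j & c' = toggle j c)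
  (c' \in toggles J c).
Proof.
apply: (iffP mapP) => [[j]|[j jJ ->]].
  by rewrite mem_filter mem_iota => /andP[jJ /andP[_ j10]] ->; exists (Ordinal j10).
by exists (val j) => //; rewrite mem_filter jJ mem_iota /=.
Qed.

Lemma reach_trans J b c d : reach J b c -> reach J c d -> reach J b d.
Proof.
move=> [s sJ ->] [t tJ ->]; exists (t ++ s); rewrite ?all_cat ?sJ ?tJ //.
by rewrite foldr_cat.
Qed.

Lemma reach_size J c d : size c = 10%N -> reach J c d -> size d = 10%N.
Proof. by move=> c10 [s _ ->]; elim: s => //= j s IHs; rewrite size_toggle. Qed.

Lemma reach_sym J c d : size c = 10%N -> reach J c d -> reach J d c.
Proof.
move=> c10 [s sJ ->]; elim: s sJ => [|j s IHs] /= => [_|/andP[jJ /IHs sc]].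
  by exists [::].
apply: reach_trans sc; exists [:: j]; rewrite /= ?jJ // toggleK //.
apply: (reach_size c10 (J := nseq 10 true)); exists s => //.
by apply/allP => i _; rewrite nth_nseq ltn_ord.
Qed.

Lemma computed_orbit_pairsP h J n : has_walls h J -> computed_orbit_pairs J = Some n ->
  BinNat.N.of_nat (orbit_pairs h) = n.
Proof.
move=> hJ; rewrite /computed_orbit_pairs; case EL: components => [L|//] [<-].
pose Q c x := size c = 10%N /\ reach J c x.
have Qnb c x y : Q c x -> y \in toggles J x -> Q c y.
  move=> [c10 cx] /togglesP[j jJ ->]; split=> //; apply: reach_trans cx _.
  by exists [:: j]; rewrite /= ?jJ.
have Qrefl c : c \in bitseqs 10 -> Q c c.
  by rewrite mem_bitseqs => /eqP c10; split=> //; exists [::].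
have [//|//|//|uniqL subL _ QL symL] := components_spec (W := [::]) Qnb Qrefl EL.
have {}symL := symL _.
rewrite !cats0 in uniqL subL.
have sizeL p x : p \in L -> x \in p.2 -> size x = 10%N.
  by move=> pL xp; have [c10 cx] := QL _ _ pL xp; exact: reach_size cx.
have {}symL : forall p x y, p \in L -> x \in p.2 -> y \in toggles J x -> y \in p.2.
  apply: symL => c x y [c10 cx] /togglesP[j jJ ->]; apply/togglesP; exists j => //.
  by rewrite toggleK //; exact: reach_size cx.
have flatE : perm_eq (bitseqs 10) (flatten (unzip2 L)).
  apply: uniq_perm; rewrite ?uniq_bitseqs // => x; apply/idP/idP => [/subL//|].
  move=> /flattenP[l /mapP[p pL ->] xp]; rewrite mem_bitseqs; apply/eqP.
  exact: sizeL xp.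
have orbitE p c x : p \in L -> c \in p.2 -> x \in bitseqs 10 ->
    `[< same_orbit h (bit_class c) (bit_class x) >] = (x \in p.2).
  move=> pL cp; rewrite mem_bitseqs => /eqP x10; have c10 := sizeL _ _ pL cp.
  apply/asboolP/idP => [/(same_orbit_reach hJ c10 x10)[s sJ ->]|xp].
    elim: s sJ => //= j s IHs /andP[jJ /IHs sp].
    by apply: symL sp _ => //; apply/togglesP; exists j.
  apply/(same_orbit_reach hJ c10 x10); have [p10 pc] := QL _ _ pL cp.
  by apply: reach_trans (reach_sym p10 pc) _; case: (QL _ _ pL xp).
rewrite /orbit_pairs (perm_big _ flatE) big_flatten big_map.
have uniq_p p : p \in L -> uniq p.2.
  move=> pL; have : subseq p.2 (flatten (unzip2 L)).
    elim: L pL {EL uniqL subL QL symL sizeL flatE orbitE} => //= q L IHL.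
    rewrite inE => /orP[/eqP->|/IHL pL]; first exact: prefix_subseq.
    exact: subseq_trans pL (suffix_subseq _ _).
  by move=> /subseq_uniq; apply.
rewrite (_ : \sum_(p <- L) _ = \sum_(p <- L) size p.2 * size p.2)%N.
  elim: (L) => [|p L' IHL]; first by rewrite big_nil.
  by rewrite big_cons /= -IHL Nnat.Nat2N.inj_add Nnat.Nat2N.inj_mul.
rewrite big_seq [RHS]big_seq; apply: eq_bigr => p pL.
rewrite big_seq (eq_bigr (fun=> size p.2)) => [|c cp].
  by rewrite -big_seq big_const_seq count_predT iter_addn_0.
rewrite (eq_in_count (a2 := mem p.2)) => [|x /(orbitE _ _ _ pL cp)//].
rewrite -size_filter; apply/perm_size/uniq_perm; rewrite ?filter_uniq ?uniq_bitseqs ?uniq_p // => x.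
rewrite mem_filter andb_idr // => xp; rewrite mem_bitseqs; apply/eqP.
exact: sizeL xp.
Qed.

Lemma perm_map_inj (T : eqType) (s : seq T) (t : T -> T) :
  uniq s -> {in s &, injective t} -> (forall c, c \in s -> t c \in s) ->
  perm_eq s (map t s).
Proof.
move=> uniq_s t_inj ts; have uniq_t : uniq (map t s) by rewrite map_inj_in_uniq.
have sub : {subset map t s <= s} by move=> _ /mapP[c /ts cs ->].
by rewrite perm_sym uniq_perm //; have [] := uniq_min_size uniq_t sub; rewrite // size_map.
Qed.

Section Invariance.
Variables (R : realType) (D : set (proj_space R[i] (2 + 2 + 8))).
Hypothesis D_component : is_component (period_domain R[i] latN) D.

Lemma orbit_pairs_class h h' :
  polarized_class D h = polarized_class D h' -> orbit_pairs h = orbit_pairs h'.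
Proof.
move=> /(polarized_class_orbits D_component)[s s_bij sE].
have ex c : exists c', size c' = 10%N /\ bit_class c' = s (bit_class c).
  by have [c' ? ?] := bit_class_surj (s (bit_class c)); exists c'.
have [t tP] := choice ex.
have t10 c : size (t c) = 10%N by case: (tP c).
have tE c : bit_class (t c) = s (bit_class c) by case: (tP c).
have t_inj : {in bitseqs 10 &, injective t}.
  move=> c d; rewrite !mem_bitseqs => /eqP c10 /eqP d10 /(congr1 bit_class).
  by rewrite !tE => /(bij_inj s_bij)/bit_class_inj; apply.
have t_perm : perm_eq (bitseqs 10) (map t (bitseqs 10)).
  apply: perm_map_inj (uniq_bitseqs 10) t_inj _ => c _.
  by rewrite mem_bitseqs t10.
rewrite /orbit_pairs (perm_big _ t_perm) big_map; apply: eq_bigr => c _.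
have /permP -> := t_perm; rewrite count_map; apply: eq_count => c' /=.
by apply/asbool_equiv_eq; rewrite !tE; split=> /sE.
Qed.
End Invariance.

(** * Classification of the faces of the fundamental chamber *)

(** The primitive vector in the interior of the face with walls [J]. *)
Definition face_vec (J : bitseq) : 'cV[int]_(2 + 8) :=
  \sum_(i < 10 | ~~ nth false J i) fund_weight i.

Lemma face_vec_root J i : (i < 10)%N ->
  B (face_vec J) (simple_root i) = (~~ nth false J i)%:R.
Proof.
move=> i10; rewrite bform_suml big_mkcond (bigD1 (Ordinal i10) isT) /= big1 => [|j ji].
  by rewrite bformC bform_root_weight // eqxx addr0; case: nth.
case: ifP => // _; rewrite bformC bform_root_weight //; case: eqP => // ij.
by rewrite -val_eqE /= ij eqxx in ji.
Qed.

Lemma positive_faceP J : size J = 10%N ->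
  reflect (exists2 i, (i < 9)%N & ~~ nth false J i) (positive_face J).
Proof.
move=> J10; apply: (iffP idP) => [/allPn[b]|[i i9 iJ]].
  move=> /(nthP false)[k]; rewrite size_take J10 /= => k9 <-; rewrite nth_take // => kJ.
  by exists k.
apply/allPn; exists false => //; apply/(nthP false); exists i; first by rewrite size_take J10.
by rewrite nth_take //; apply/negbTE.
Qed.

Lemma face_vec_walls J : size J = 10%N -> positive_face J -> has_walls (face_vec J) J.
Proof.
move=> J10 /(positive_faceP J10)[i i9 iJ]; split; last first.
  by move=> j j10; rewrite /walls face_vec_root //; case: nth.
split; last by move=> j j10; rewrite face_vec_root // ler0n.
pose r : 'cV[int]_(2 + 8) := face_vec J - fund_weight i.
have i10 : (i < 10)%N by exact: leqW.
have rd j : (j < 10)%N -> 0 <= B r (simple_root j).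
  move=> j10; rewrite bformDl bformNl face_vec_root // (bformC _ (fund_weight i)).
  rewrite bform_root_weight //; case: eqP => [->|_]; first by rewrite iJ subrr.
  by rewrite subr0 ler0n.
have -> : face_vec J = fund_weight i + r by rewrite addrC subrK.
have wd j : (j < 10)%N -> 0 <= B (fund_weight i) (simple_root j) by apply: weight_dominant.
have rr := bform_dominant rd rd; have wr := bform_dominant wd rd.
have := bform_weight_gt0 i9; move: (r) rr wr => {rd} q; move: (fund_weight i) => w.
rewrite !(bformDl, bformDr) (bformC _ q w); move: (B q q) (B w q) (B w w) => a b c; lia.
Qed.

Lemma face_vec_primitive J : size J = 10%N -> positive_face J -> primitive (face_vec J).
Proof.
move=> J10 /(positive_faceP J10)[i i9 iJ] k v hv.
have := face_vec_root J (leqW i9); rewrite hv bformZl iJ /= => kv.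
by apply/unitrPr; exists (B v (simple_root i)).
Qed.

Lemma size_adjacent_face J s J' : adjacent_face J s = Some J' -> size J' = 10%N.
Proof.
rewrite /adjacent_face; set imgs := [seq _ | _ <- _ & _].
by case: ifP => // _ [<-]; rewrite size_mkseq.
Qed.

Definition positive_faces := [seq J <- bitseqs 10 | positive_face J].

Definition separated_classes (o : option (seq (bitseq * seq bitseq))) : bool :=
  if o is Some L then
    let st := map computed_orbit_pairs (unzip1 L) in [&& size st == 87%N, all isSome st & uniq st]
  else false.

Lemma separated_classesP o : separated_classes o -> exists L,
  [/\ o = Some L, size L = 87%N, all isSome (map computed_orbit_pairs (unzip1 L))
    & uniq (map computed_orbit_pairs (unzip1 L))].
Proof.
case: o => // L /and3P[+ okL uniqL]; rewrite !size_map => /eqP sizeL.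
by exists L; split.
Qed.

(** The one large computation: the moves connect the positive faces into 87 families,
    and the orbit pairs of their representatives are pairwise distinct. *)
Lemma face_components_separated :
  separated_classes (components adjacent_faces (2 ^ 14)%N positive_faces Leaf).
Proof. vm_cast_no_check (erefl true). Qed.

(** Hides the concrete values of the fuel and of the list of faces, so that no later
    conversion test evaluates the search. *)
Lemma face_components_exist : exists fuel univ L,
  [/\ univ =i positive_faces, components adjacent_faces fuel univ Leaf = Some L, size L = 87%N,
      all isSome (map computed_orbit_pairs (unzip1 L))
    & uniq (map computed_orbit_pairs (unzip1 L))].
Proof.
have [L [EL sizeL okL uniqL]] := separated_classesP face_components_separated.
exact (ex_intro _ _ (ex_intro _ _ (ex_intro _ L (And5 (fun=> erefl) EL sizeL okL uniqL)))).
Qed.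

Lemma mem_positive_faces J : (J \in positive_faces) = (size J == 10%N) && positive_face J.
Proof. by rewrite mem_filter mem_bitseqs andbC. Qed.

Section Classification.
Variables (R : realType) (D : set (proj_space R[i] (2 + 2 + 8))).
Hypothesis D_component : is_component (period_domain R[i] latN) D.

Lemma polarized_class_stab h h' :
  (forall f, isom_stab h f <-> isom_stab h' f) -> polarized_class D h = polarized_class D h'.
Proof.
move=> hh'; apply: (polarized_class_conj D_component (s := 1%g)) => f.
by rewrite invg1 mul1g mulg1.
Qed.

(** The stabilizer of a dominant vector only depends on its walls. *)
Lemma polarized_class_walls h h' J : has_walls h J -> has_walls h' J ->
  polarized_class D h = polarized_class D h'.
Proof.
move=> hJ h'J; have [[hd _] [h'd _]] := (hJ, h'J); apply: polarized_class_stab => f.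
by split=> /stabilizerE => /(_ ltac:(done))[s sJ ->]; apply/stabilizerE => //;
  exists s => //; move: sJ; rewrite (has_walls_all _ hJ) (has_walls_all _ h'J).
Qed.

Lemma polarized_class_act h (w : isometry latM) :
  polarized_class D h = polarized_class D (isom_act w h).
Proof.
apply: (polarized_class_conj D_component (s := w)) => f; rewrite /isom_stab /=.
rewrite !isom_actM isom_actK; split=> [->//|]; exact: isom_act_inj.
Qed.

Lemma polarized_class_opp h : polarized_class D h = polarized_class D (- h).
Proof.
apply: polarized_class_stab => f; rewrite /isom_stab /= isom_actN.
by split=> [->//|/oppr_inj].
Qed.

Definition face_class (J : bitseq) := polarized_class D (face_vec J).

(** If all simple roots but the last one were walls of [h], then [h] would be a multiple
    of the isotropic weight. *)
Lemma dominant_face_class h : dominant h ->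
  exists2 J, (size J == 10%N) && positive_face J & polarized_class D h = face_class J.
Proof.
move=> hd; pose J := mkseq (walls h) 10.
have J10 : size J = 10%N by rewrite size_mkseq.
have hJ : has_walls h J by split=> // i i10; rewrite nth_mkseq.
have Jv : positive_face J.
  apply/(positive_faceP J10); apply: contrapT => noJ.
  have hi i : (i < 9)%N -> B h (simple_root i) = 0.
    move=> i9; apply: contrapT => /eqP hi; apply: noJ; exists i => //.
    by rewrite nth_mkseq // leqW.
  have : B h h = 0; last by have [hh _] := hd; move=> hh0; rewrite hh0 ltxx in hh.
  rewrite (_ : h = B h (simple_root 9) *: fund_weight 9).
    rewrite bformZl bformZr bform_vec10.
    by rewrite [list_form _ _](_ : _ = 0) ?mulr0.
  rewrite [LHS]weight_expansion big_ord_recr big1 => [|i _]; first exact: add0r.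
  by rewrite (hi _ (ltn_ord i)) scale0r.
exists J; first by rewrite J10 eqxx.
exact: polarized_class_walls hJ (face_vec_walls J10 Jv).
Qed.

Lemma positive_vector_face_class h : 0 < B h h ->
  exists2 J, (size J == 10%N) && positive_face J & polarized_class D h = face_class J.
Proof.
move=> hh; have := positive_entry0_neq0 hh; rewrite neq_lt => /orP[h0|h0]; last first.
  have [w /dominant_face_class[J Jv hJ]] := dominant_conj hh h0.
  by exists J => //; rewrite (polarized_class_act h w).
have Nhh : 0 < B (- h) (- h) by rewrite bformNl bformNr opprK.
have Nh0 : 0 < entry (- h) 0%N by rewrite -[- h]sub0r entryB entry0 sub0r oppr_gt0.
have [w /dominant_face_class[J Jv hJ]] := dominant_conj Nhh Nh0.
by exists J => //; rewrite polarized_class_opp (polarized_class_act (- h) w).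
Qed.

(** Conjugation by [w] turns the reflection in a root into the reflection in its image. *)
Lemma parabolic_conj (J J' : pred nat) (w f : isometry latM) :
  (forall j : 'I_10, J j -> exists2 i : 'I_10, J' i & isom_act w (simple_root j) = simple_root i) ->
  parabolic J f -> parabolic J' (w * f * w^-1)%g.
Proof.
move=> wJ [s + ->]; elim: s => [|j s IHs] /=.
  by rewrite big_nil mulg1 mulgV; exists [::]; rewrite ?big_nil.
move=> /andP[/wJ[i J'i wji] /IHs]; rewrite big_cons => ps.
rewrite (_ : (w * _ * _)%g = ((w * simple_reflection j * w^-1) *
    (w * \prod_(k <- s) simple_reflection k * w^-1))%g).
  apply: parabolicM ps; rewrite (simple_reflection_conj wji).
  by exists [:: i]; rewrite /= ?J'i // big_seq1.
by rewrite !mulgA mulgVK.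
Qed.

Lemma root_comb_word (w : seq nat) : all (gtn 10) w -> exists g : isometry latM,
  forall x, isom_act g (root_comb x) = root_comb (foldl (fun x i => root_refl i x) x w).
Proof.
elim: w => [_|i w IHw /= /andP[i10 /IHw[g gE]]]; first by exists 1%g => x; rewrite isom_act1.
exists (g * simple_reflection (Ordinal i10))%g => x.
by rewrite isom_actM root_comb_refl gE.
Qed.

Lemma lowering_word_lt fuel u y : all (gtn 10) (lowering_word fuel u y).
Proof. by elim: fuel y => //= fuel IHf y; case: ifP => //= ->; exact: IHf. Qed.

(** The element found maps the simple roots in [J] bijectively to those in [J'], hence
    conjugates one stabilizer into the other. *)
Lemma adjacent_face_class J s J' : size J = 10%N -> positive_face J ->
  adjacent_face J s = Some J' -> positive_face J' ->
  face_class J = face_class J'.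
Proof.
move=> J10 Jv; rewrite /adjacent_face; set w := lowering_word _ _ _.
set imgs := [seq _ | _ <- _ & _].
case: ifP => // /allP imgsP [<-]; set J1 := mkseq _ _ => J1v.
have [g gE] := root_comb_word (lowering_word_lt 128 (set_nth false J s true) (unit_list s)).
have J1_10 : size J1 = 10%N by rewrite size_mkseq.
have [hJ hJ1] := (face_vec_walls J10 Jv, face_vec_walls J1_10 J1v).
have fwd (j : 'I_10) : nth false J j ->
    exists2 i : 'I_10, nth false J1 i & isom_act g (simple_root j) = simple_root i.
  move=> jJ; pose x := foldl (fun x i => root_refl i x) (unit_list j) w.
  have xI : x \in imgs.
    by apply/mapP; exists (val j) => //; rewrite mem_filter jJ mem_iota /=.
  have /mapP[k] := imgsP x xI; rewrite mem_iota /= => k10 xE.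
  exists (Ordinal k10); first by rewrite nth_mkseq // -xE.
  by rewrite -root_comb_unit // gE -/w -/x xE root_comb_unit.
have bwd (i : 'I_10) : nth false J1 i ->
    exists2 j : 'I_10, nth false J j & isom_act g^-1%g (simple_root i) = simple_root j.
  rewrite nth_mkseq // => /mapP[j]; rewrite mem_filter mem_iota => /andP[jJ /andP[_ j10]] xE.
  exists (Ordinal j10) => //; apply: (@isom_act_inj _ _ _ g); rewrite isom_actVK.
  by rewrite /= -(root_comb_unit j10) gE -xE root_comb_unit.
apply: (polarized_class_conj D_component (s := g)) => f.
have [[hd hw] [h1d h1w]] := (hJ, hJ1).
split=> /stabilizerE => [/(_ hd)|/(_ h1d)] pf; apply/stabilizerE => //.
  apply: parabolic_conj pf => j; rewrite hw // => /fwd[i iJ1 gi].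
  by exists i => //; rewrite h1w.
have -> : f = (g^-1 * (g * f * g^-1) * g^-1^-1)%g by rewrite invgK !mulgA mulVg mul1g mulgVK.
apply: parabolic_conj pf => j; rewrite h1w // => /bwd[i iJ gi].
by exists i => //; rewrite hw.
Qed.

Lemma face_class_rep fuel univ L J : univ =i positive_faces ->
  components adjacent_faces fuel univ Leaf = Some L -> J \in positive_faces ->
  exists2 J', J' \in unzip1 L & face_class J = face_class J'.
Proof.
move=> univE EL JF; pose Q c x := [/\ size x = 10%N, positive_face x & face_class x = face_class c].
have Qnb c x y : Q c x -> y \in adjacent_faces x -> Q c y.
  move=> [x10 xv xc]; rewrite mem_filter mem_pmap => /andP[yv /mapP[s _ xs]].
  have y10 := size_adjacent_face (esym xs); have xy := adjacent_face_class x10 xv (esym xs) yv.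
  clear xs; split=> //; exact: etrans (esym xy) xc.
have Qrefl c : c \in univ -> Q c c.
  by rewrite univE mem_positive_faces => /andP[/eqP c10 cv].
have [//|//|//|_ subL _ QL _] := components_spec (W := [::]) Qnb Qrefl EL.
rewrite -univE in JF; have := subL J JF; rewrite cats0 => /flattenP[l /mapP[p pL ->] Jp].
by exists p.1; [exact: map_f|case: (QL _ _ pL Jp)].
Qed.

Lemma face_class_orbit_pairs J J' n n' : J \in positive_faces -> J' \in positive_faces ->
  computed_orbit_pairs J = Some n -> computed_orbit_pairs J' = Some n' ->
  face_class J = face_class J' ->
  computed_orbit_pairs J = computed_orbit_pairs J'.
Proof.
rewrite !mem_positive_faces => /andP[/eqP J10 Jv] /andP[/eqP J'10 J'v] Jn J'n.
move=> /(orbit_pairs_class D_component) JJ'; rewrite Jn J'n; congr Some.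
rewrite -(computed_orbit_pairsP (face_vec_walls J10 Jv) Jn).
by rewrite -(computed_orbit_pairsP (face_vec_walls J'10 J'v) J'n) JJ'.
Qed.

End Classification.

Theorem theorem3p5 (R : realType) (D : set (proj_space R[i] (2 + 2 + 8)))
    (D_component : is_component (period_domain R[i] latN) D) :
  [set conj_class (isom_plus latN D) (Gamma h `&` isom_plus latN D)
    | h in [set h : 'cV[int]_(2 + 8) | primitive h /\ 0 < bform latMhalf h h]]
  #= `I_87.
Proof.
have [fuel [univ [L [univE EL sizeL okL uniqL]]]] := face_components_exist.
pose reps := unzip1 L.
have size_reps : size reps = 87%N by rewrite size_map.
have repsF J : J \in reps -> J \in positive_faces.
  have Qnb (c x y : bitseq) : True -> y \in adjacent_faces x -> True by [].
  have [//|//|//|_ _ sub _ _] := components_spec (W := [::]) (Q := fun _ _ => True)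
    Qnb (fun _ _ => I) EL.
  by move=> /sub; rewrite univE.
pose F k := face_class D (nth [::] reps k).
have nth_reps k : (k < 87)%N -> nth [::] reps k \in reps by move=> k87; rewrite mem_nth ?size_reps.
have F_inj : {in `I_87 &, injective F}.
  move=> k l; rewrite !inE /= => k87 l87 kl; apply/eqP.
  have stat_some m : (m < 87)%N -> exists n, computed_orbit_pairs (nth [::] reps m) = Some n.
    move=> m87; have /allP/(_ (computed_orbit_pairs (nth [::] reps m))) := okL.
    by rewrite map_f ?nth_reps // => /(_ isT); case: computed_orbit_pairs => // n _; exists n.
  have [[n kn] [n' ln]] := (stat_some k k87, stat_some l l87).
  have := face_class_orbit_pairs D_component
    (repsF _ (nth_reps k k87)) (repsF _ (nth_reps l l87)) kn ln kl.
  rewrite -!(nth_map _ None computed_orbit_pairs) ?size_reps // => /eqP.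
  by rewrite nth_uniq // size_map size_reps.
rewrite (_ : [set _ | _ in _] = F @` `I_87); first exact: inj_card_eq.
apply/seteqP; split=> [_ [h [_ hpos] <-]|_ [k /= k87 <-]].
  have [J JF hJ] := positive_vector_face_class D_component hpos.
  have JF' : J \in positive_faces by rewrite mem_positive_faces.
  have [J' J'L JJ'] := face_class_rep D_component univE EL JF'.
  exists (index J' reps); first by rewrite /= -size_reps index_mem.
  by rewrite /F nth_index // -JJ' -hJ.
have := repsF _ (nth_reps k k87); rewrite mem_positive_faces => /andP[/eqP J10 Jv].
exists (face_vec (nth [::] reps k)) => //; split; first exact: face_vec_primitive.
by have [[]] := face_vec_walls J10 Jv.
Qed.
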